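(* There is a universal constant $c>0$ such that for every integer $n\ge1$ and every lattice $\Lambda\subseteq\mathbb{R}^n$ of rank $n$, $$c_1(\mathbb{R}^n/\Lambda)\ \ge\ c\cdot\frac{N(\Lambda^* )}{r(\Lambda^* )}\cdot\sqrt{n}.$$
   Context: For a rank $n$ lattice $\Lambda\subseteq\mathbb{R}^n$, the dual lattice is $\Lambda^*=\{x\in\mathbb{R}^n:\ \forall y\in\Lambda,\ \langle x,y\rangle\in\mathbb{Z}\}$, and $N(\Lambda)=\min_{x\in\Lambda\setminus\{0\}}\|x\|_2$, $r(\Lambda)=\max_{x\in\mathbb{R}^n}\min_{y\in\Lambda}\|x-y\|_2$. The flat torus $\mathbb{R}^n/\Lambda$ carries its Riemannian (quotient) metric $d_{\mathbb{R}^n/\Lambda}(x+\Lambda,y+\Lambda)=\min_{z\in\Lambda}\|x-y-z\|_2$. Distortion: for metric spaces $(X,d_X),(Y,d_Y)$ and $f:X\to Y$, $\|f\|_{\mathrm{Lip}}=\sup_{x\ne y} d_Y(f(x),f(y))/d_X(x,y)$. If $f$ is one-to-one, $\mathrm{dist}(f)=\|f\|_{\mathrm{Lip}}\cdot\|f^{-1}\|_{\mathrm{Lip}}$ (with $f^{-1}$ defined on $f(X)$); otherwise $\mathrm{dist}(f)=\infty$. $c_Y(X)=\inf\{\mathrm{dist}(f): f:X\to Y\}$, and $c_1(X)=c_{L_1}(X)$, where $L_1=L_1([0,1])$. *)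

(* Defs.v *)
From HB Require Import structures.
From mathcomp Require Import all_boot all_order all_algebra.
From mathcomp Require Import all_classical all_reals all_analysis.
From mathcomp Require Import measurable_realfun.
From mathcomp Require Import ring lra.
Set Implicit Arguments.
Unset Strict Implicit.
Unset Printing Implicit Defensive.
Import Order.TTheory GRing.Theory Num.Theory.
Import numFieldNormedType.Exports.
Local Open Scope classical_set_scope.
Local Open Scope ring_scope.

(* The library norm on 'rV[R]_n is the sup norm, hence a Euclidean one. *)
Section Euclidean.
Context {R : realType} {n : nat}.
Implicit Types (x y : 'rV[R]_n) (A : set 'rV[R]_n).

Definition dotv x y : R := \sum_(i < n) x 0 i * y 0 i.

Definition norm2 x : R := Num.sqrt (dotv x x).

Lemma dotvC x y : dotv x y = dotv y x.
Proof. by apply: eq_bigr => i _; rewrite mulrC. Qed.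

Lemma dotvDl x y z : dotv (x + y) z = dotv x z + dotv y z.
Proof. by rewrite -big_split; apply: eq_bigr => i _; rewrite mxE mulrDl. Qed.

Lemma dotvDr x y z : dotv z (x + y) = dotv z x + dotv z y.
Proof. by rewrite dotvC dotvDl !(dotvC z). Qed.

Lemma dotvZl a x y : dotv (a *: x) y = a * dotv x y.
Proof. by rewrite mulr_sumr; apply: eq_bigr => i _; rewrite mxE mulrA. Qed.

Lemma dotvZr a x y : dotv x (a *: y) = a * dotv x y.
Proof. by rewrite dotvC dotvZl dotvC. Qed.

Lemma dotv_ge0 x : 0 <= dotv x x.
Proof. by apply: sumr_ge0 => i _; rewrite -expr2 sqr_ge0. Qed.

Lemma dotv_eq0 x : dotv x x = 0 -> x = 0.
Proof.
move=> x0; apply/rowP => i; rewrite mxE; apply/eqP; rewrite -sqrf_eq0 expr2.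
have /eqP := x0; rewrite psumr_eq0; last by move=> j _; rewrite -expr2 sqr_ge0.
by move/allP/(_ i); rewrite mem_index_enum implyTb => /(_ isT).
Qed.

Lemma dotv_cauchy x y : dotv x y ^+ 2 <= dotv x x * dotv y y.
Proof.
have [y0|y0] := eqVneq (dotv y y) 0.
  rewrite y0 mulr0 (dotv_eq0 y0) /dotv big1 ?expr0n// => i _.
  by rewrite mxE mulr0.
have yp : 0 < dotv y y by rewrite lt_neqAle eq_sym y0 dotv_ge0.
have := dotv_ge0 (dotv y y *: x + (- dotv x y) *: y).
rewrite !(dotvDl, dotvDr, dotvZl, dotvZr) (dotvC y x).
set a := dotv x y; set b := dotv y y; set c := dotv x x.
rewrite [leRHS](_ : _ = b * (c * b - a ^+ 2)); last by ring.
by rewrite pmulr_rge0// subr_ge0.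
Qed.

Lemma norm2_ge0 x : 0 <= norm2 x.
Proof. exact: sqrtr_ge0. Qed.

Lemma norm2N x : norm2 (- x) = norm2 x.
Proof. by rewrite /norm2 -scaleN1r dotvZl dotvZr !mulN1r opprK. Qed.

Lemma norm20 : norm2 0 = 0 :> R.
Proof. by rewrite /norm2 -(scale0r 0) dotvZr mul0r sqrtr0. Qed.

Lemma norm2_triangle x y : norm2 (x + y) <= norm2 x + norm2 y.
Proof.
rewrite -(@ler_pXn2r _ 2) ?nnegrE ?addr_ge0 ?norm2_ge0//.
have xy : dotv x y <= norm2 x * norm2 y.
  by rewrite (le_trans (ler_norm _))// -sqrtr_sqr -sqrtrM ?dotv_ge0// ler_wsqrtr//
             dotv_cauchy.
rewrite sqrrD !sqr_sqrtr ?dotv_ge0// dotvDl !dotvDr (dotvC y x).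
by lra.
Qed.

Lemma ler_coord_norm2 x i : `|x 0 i| <= norm2 x.
Proof.
rewrite -sqrtr_sqr ler_wsqrtr// /dotv (bigD1 i)//= -expr2 lerDl.
by apply: sumr_ge0 => j _; rewrite -expr2 sqr_ge0.
Qed.

Definition dual_lattice A : set 'rV[R]_n :=
  [set x | forall y, A y -> dotv x y \is a Num.int].

(* N(A); for a full-rank lattice this infimum, and the infimum and supremum in
   covering_radius, are attained. *)
Definition min_length A : R := inf [set norm2 x | x in A `\ 0].

(* r(A) *)
Definition covering_radius A : R :=
  sup [set inf [set norm2 (x - y) | y in A] | x in [set: 'rV[R]_n]].

End Euclidean.

(* The integer combinations of the rows of B, which form a basis of R^n. *)
Record lattice (R : realType) (n : nat) := Lattice {
  lattice_set :> set 'rV[R]_n;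
  latticeP : exists2 B : 'M[R]_n, B \in unitmx &
    lattice_set = [set map_mx intr k *m B | k in [set: 'rV[int]_n]] }.

Section Lattice.
Context {R : realType} {n : nat}.
Variable L : lattice R n.

Lemma lattice0 : lattice_set L 0.
Proof.
have [B _ ->] := latticeP L; exists 0 => //.
by rewrite map_mx0 mul0mx.
Qed.

Lemma latticeB x y : lattice_set L x -> lattice_set L y -> lattice_set L (x - y).
Proof.
have [B _ ->] := latticeP L => -[k _ <-] [l _ <-]; exists (k - l) => //.
by rewrite map_mxB mulmxBl.
Qed.

Lemma latticeN x : lattice_set L x -> lattice_set L (- x).
Proof. by move=> Lx; rewrite -sub0r; apply: latticeB => //; exact: lattice0. Qed.

Lemma latticeD x y : lattice_set L x -> lattice_set L y -> lattice_set L (x + y).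
Proof. by move=> Lx Ly; rewrite -[y]opprK; exact/latticeB/latticeN. Qed.

Lemma lattice_discrete :
  exists2 e : R, 0 < e & forall x, lattice_set L x -> norm2 x < e -> x = 0.
Proof.
have [B Bu LE] := latticeP L.
pose C : R := 1 + \sum_i \sum_j `|invmx B j i|.
have C0 : 0 < C.
  by rewrite ltr_pwDl// sumr_ge0// => i _; rewrite sumr_ge0.
exists C^-1; first by rewrite invr_gt0.
move=> x; rewrite LE => -[k _ <-{x}].
set x := _ *m B => xC.
suff k0 : k = 0 by rewrite /x k0 map_mx0 mul0mx.
apply/rowP => i; rewrite mxE; apply/eqP; rewrite -[_ == _]negbK.
apply/negP => ki0.
have : 1 <= `|(k 0 i)%:~R : R| by rewrite norm_intr_ge1 ?intr_int ?intr_eq0.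
apply/negP; rewrite -ltNge.
have -> : (k 0 i)%:~R = \sum_j x 0 j * invmx B j i.
  have : map_mx intr k = x *m invmx B by rewrite /x mulmxK.
  by move/matrixP/(_ 0 i); rewrite !mxE.
apply: (le_lt_trans (ler_norm_sum _ _ _)).
apply: (@le_lt_trans _ _ (norm2 x * \sum_j `|invmx B j i|)).
  rewrite mulr_sumr ler_sum// => j _; rewrite normrM ler_wpM2r//.
  exact: ler_coord_norm2.
apply: (@le_lt_trans _ _ (norm2 x * C)).
  rewrite ler_wpM2l ?norm2_ge0// /C [X in 1 + X](bigD1 i)//= addrCA lerDl.
  by rewrite addr_ge0// sumr_ge0// => l _; rewrite sumr_ge0.
by rewrite -ltr_pdivlMr// mul1r.
Qed.

Definition lattice_eq (x y : 'rV[R]_n) : bool := `[< lattice_set L (x - y) >].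

Lemma lattice_eq_equiv : equiv_class_of lattice_eq.
Proof.
split=> [x|x y|y x z].
- by apply/asboolP; rewrite subrr; exact: lattice0.
- by apply/asboolP/asboolP => /latticeN; rewrite opprB.
- move=> /asboolP xy /asboolP yz; apply/asboolP.
  by rewrite -(subrK y x) -addrA; exact: latticeD.
Qed.

Canonical lattice_eq_canonical := EquivRelPack lattice_eq_equiv.

End Lattice.

Section FlatTorus.
Context {R : realType} {n : nat}.
Variable L : lattice R n.
Local Open Scope quotient_scope.

(* R^n/L *)
Definition torus : Type := {eq_quot (lattice_eq L)}.
HB.instance Definition _ := Choice.on torus.
HB.instance Definition _ := EqQuotient.on torus.

Implicit Types (a b c : torus) (x y z : 'rV[R]_n).

Definition coset_dist x y : R := inf [set norm2 (x - y - z) | z in lattice_set L].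

Lemma coset_dist_has_inf x y :
  has_inf [set norm2 (x - y - z) | z in lattice_set L].
Proof.
split; first by exists (norm2 (x - y - 0)); exists 0 => //; exact: lattice0.
by exists 0 => _ [z _ <-]; exact: norm2_ge0.
Qed.

Lemma coset_dist_le x y z : lattice_set L z -> coset_dist x y <= norm2 (x - y - z).
Proof. by move=> Lz; apply: ge_inf; [exact: (coset_dist_has_inf x y).2|exists z]. Qed.

Lemma coset_dist_adherent x y e : 0 < e ->
  exists2 z, lattice_set L z & norm2 (x - y - z) < coset_dist x y + e.
Proof.
by move=> /inf_adherent/(_ (coset_dist_has_inf x y))[_ [z Lz <-]]; exists z.
Qed.

Lemma coset_dist_ge0 x y : 0 <= coset_dist x y.
Proof.
apply: lb_le_inf; first exact: (coset_dist_has_inf x y).1.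
by move=> _ [z _ <-]; exact: norm2_ge0.
Qed.

Lemma coset_dist_translate x y u v : lattice_set L u -> lattice_set L v ->
  coset_dist (x + u) (y + v) = coset_dist x y.
Proof.
move=> Lu Lv; congr inf; apply/seteqP; split=> _ [z Lz <-].
- exists (z - u + v); first by apply: latticeD => //; exact: latticeB.
  by congr norm2; apply/rowP => i; rewrite !mxE; ring.
- exists (z + u - v); first by apply: latticeB => //; exact: latticeD.
  by congr norm2; apply/rowP => i; rewrite !mxE; ring.
Qed.

Definition torus_dist a b : R := coset_dist (repr a) (repr b).

Lemma torus_distE x y :
  torus_dist (\pi_torus x) (\pi_torus y) =
  inf [set norm2 (x - y - z) | z in lattice_set L].
Proof.
have reprE u : exists2 v, lattice_set L v & repr (\pi_torus u) = u + v.
  exists (repr (\pi_torus u) - u); last by rewrite addrC subrK.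
  by apply/asboolP; apply/(@eqmodP _ (lattice_eq_canonical L)); rewrite reprK.
have [u Lu xu] := reprE x; have [v Lv yv] := reprE y.
by rewrite /torus_dist xu yv coset_dist_translate.
Qed.

Let torus_distxx a : torus_dist a a = 0.
Proof.
apply/eqP; rewrite eq_le coset_dist_ge0 andbT.
by apply: le_trans (coset_dist_le _ _ (lattice0 L)) _; rewrite subrr subr0 norm20.
Qed.

Let torus_dist_positivity a b : torus_dist a b = 0 -> a = b.
Proof.
move=> ab0; have [e e0 eL] := lattice_discrete L.
have e2 : 0 < e / 2 by rewrite divr_gt0.
have [z Lz] := coset_dist_adherent (repr a) (repr b) e2.
rewrite -/(torus_dist a b) ab0 add0r => ze.
suff abz : norm2 (repr a - repr b - z) <= 0.
  rewrite -[a]reprK -[b]reprK; apply/(@eqmodP _ (lattice_eq_canonical L)).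
  apply/asboolP; suff -> : repr a - repr b = z by [].
  apply/eqP; rewrite -subr_eq0; apply/eqP/rowP => i; rewrite [RHS]mxE.
  by apply/eqP; rewrite -normr_le0; exact: le_trans (ler_coord_norm2 _ _) abz.
apply/ler_addgt0Pl => d d0; rewrite addr0.
have m0 : 0 < Num.min d (e / 2) by rewrite lt_min d0.
have [w Lw] := coset_dist_adherent (repr a) (repr b) m0.
rewrite -/(torus_dist a b) ab0 add0r lt_min => /andP[wd we].
suff -> : z = w by exact: ltW.
apply/eqP; rewrite -subr_eq0; apply/eqP/eL; first exact: latticeB.
have -> : z - w = (repr a - repr b - w) + - (repr a - repr b - z).
  by apply/rowP => i; rewrite !mxE; ring.
rewrite (le_lt_trans (norm2_triangle _ _))// norm2N.
by rewrite (splitr e) ltrD.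
Qed.

Let torus_dist_sym a b : torus_dist a b = torus_dist b a.
Proof.
congr inf; apply/seteqP; split=> _ [z Lz <-]; exists (- z);
  try exact: latticeN; by rewrite -norm2N; congr norm2; apply/rowP => i;
    rewrite !mxE; ring.
Qed.

Let torus_dist_triangle b a c : torus_dist a c <= torus_dist a b + torus_dist b c.
Proof.
apply/ler_addgt0Pl => e e0; have e2 : 0 < e / 2 by rewrite divr_gt0.
have [z Lz ze] := coset_dist_adherent (repr a) (repr b) e2.
have [w Lw we] := coset_dist_adherent (repr b) (repr c) e2.
have := coset_dist_le (repr a) (repr c) (latticeD Lz Lw).
have -> : repr a - repr c - (z + w) =
    (repr a - repr b - z) + (repr b - repr c - w).
  by apply/rowP => i; rewrite !mxE; ring.
have := norm2_triangle (repr a - repr b - z) (repr b - repr c - w).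
move: ze we; rewrite -/(torus_dist a b) -/(torus_dist b c) -/(torus_dist a c).
by lra.
Qed.

HB.instance Definition _ := isMetric.Build R torus
  torus_distxx torus_dist_positivity torus_dist_sym torus_dist_triangle.

End FlatTorus.

Section L1.
Context {R : realType}.

Definition lebesgue01 : {measure set (measurableTypeR R) -> \bar R} :=
  mrestr (@lebesgue_measure R) (measurable_itv `[0, 1]).

(* L_1([0,1]): classes modulo a.e. equality on [0,1] of measurable functions
   R -> R that are integrable on [0,1]. *)
Definition L1 : Type := LspaceType1 lebesgue01.
HB.instance Definition _ := gen_eqMixin L1.
HB.instance Definition _ := gen_choiceMixin L1.

Definition L1_fun (f : L1) : measurableTypeR R -> R :=
  aqEqMfun_to_fun (LebesgueSpace.sort f).

Implicit Types f g h : L1.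

Definition L1_dist f g : R :=
  fine ('N[lebesgue01]_1[EFin \o (L1_fun f \- L1_fun g)%R])%E.

Lemma measurable_L1_fun f : measurable_fun [set: measurableTypeR R] (L1_fun f).
Proof.
exact: (@measurable_funPT _ _ _ _ (repr (LebesgueSpace.sort f))).
Qed.

Let LnormN (u : measurableTypeR R -> R) :
  'N[lebesgue01]_1[EFin \o (\- u)%R]%E = 'N[lebesgue01]_1[EFin \o u]%E.
Proof. by rewrite -[RHS]oppe_Lnorm; exact: eq_Lnorm. Qed.

Lemma L1_distE f g : (L1_dist f g)%:E =
  'N[lebesgue01]_1[EFin \o (L1_fun f \- L1_fun g)%R]%E.
Proof.
have fin u : ('N[lebesgue01]_1[EFin \o L1_fun u] < +oo)%E.
  exact: (isFinLebesgue.Lebesgue_finite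
           (LebesgueSpace.hoelder_isFinLebesgue_mixin (LebesgueSpace.class u))).
rewrite fineK// ge0_fin_numE ?Lnorm_ge0//.
have mN : measurable_fun [set: measurableTypeR R] (\- L1_fun g)%R.
  by apply: measurableT_comp; last exact: measurable_L1_fun.
apply: le_lt_trans (eminkowski lebesgue01 (measurable_L1_fun f) mN (lexx _)) _.
by rewrite lte_add_pinfty// LnormN.
Qed.

Let L1_distxx f : L1_dist f f = 0.
Proof.
apply: EFin_inj; rewrite L1_distE.
rewrite (_ : EFin \o _ = cst 0%E) ?Lnorm0//.
by apply/funext => x /=; rewrite subrr.
Qed.

Let L1_dist_positivity f g : L1_dist f g = 0 -> f = g.
Proof.
move=> fg0; have Nfg := L1_distE f g; rewrite fg0 in Nfg.
have /= := Lnorm_eq0_eq0 _ lte01 (esym Nfg).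
move=> /(_ ltac:(by apply/measurable_EFinP; apply: measurable_funB;
                    exact: measurable_L1_fun)) {Nfg fg0}.
case: f g => [f [[fp]]] [g [[gp]]] /= aefg.
have fg : f = g.
  rewrite -[f]reprK -[g]reprK; apply/eqP/ae_eqP.
  apply: filterS aefg => x /= /(_ I) [] /eqP; rewrite subr_eq0 => /eqP.
  by move=> + _.
by subst g; rewrite (Prop_irrelevance fp gp).
Qed.

Let L1_dist_sym f g : L1_dist f g = L1_dist g f.
Proof.
apply: EFin_inj; rewrite !L1_distE -LnormN; apply: eq_Lnorm => x /=.
by rewrite opprB.
Qed.

Let L1_dist_triangle g f h : L1_dist f h <= L1_dist f g + L1_dist g h.
Proof.
rewrite -lee_fin EFinD !L1_distE.
rewrite (_ : (L1_fun f \- L1_fun h)%R =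
   ((L1_fun f \- L1_fun g) \+ (L1_fun g \- L1_fun h))%R); last first.
  by apply/funext => x /=; rewrite addrA subrK.
by apply: eminkowski => //; apply: measurable_funB; exact: measurable_L1_fun.
Qed.

HB.instance Definition _ := isMetric.Build R L1
  L1_distxx L1_dist_positivity L1_dist_sym L1_dist_triangle.

End L1.
Arguments L1 R : clear implicits.

Section Distortion.
Context {R : realType}.

Section ImageMetric.
Context {X Y : metricType R}.
Variable f : X -> Y.

(* f(X) with the metric of Y *)
Definition image_space : Type := set_type (range f).
HB.instance Definition _ := Choice.on image_space.

Definition image_dist (u v : image_space) : R := mdist (val u) (val v).

Let image_distxx u : image_dist u u = 0. Proof. exact: mdistxx. Qed.

Let image_dist_positivity u v : image_dist u v = 0 -> u = v.
Proof. by move/mdist_positivity/val_inj. Qed.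

Let image_dist_sym u v : image_dist u v = image_dist v u.
Proof. exact: metric_sym. Qed.

Let image_dist_triangle v u w : image_dist u w <= image_dist u v + image_dist v w.
Proof. exact: metric_triangle. Qed.

HB.instance Definition _ := isMetric.Build R image_space
  image_distxx image_dist_positivity image_dist_sym image_dist_triangle.

(* A right inverse f(X) -> X of f; it is f^-1 when f is one-to-one. *)
Definition image_inv (u : image_space) : X := s2val (cid2 (set_valP u)).

Lemma image_invK u : f (image_inv u) = val u.
Proof. by rewrite /image_inv; case: cid2. Qed.

End ImageMetric.

Local Open Scope ereal_scope.

(* The element 0 only matters when X has at most one point, where the supremum
   of an empty set of nonnegative numbers is read as 0. *)
Definition Lip {X Y : metricType R} (f : X -> Y) : \bar R :=
  ereal_sup (0 |` [set r | exists x y : X, x != y /\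
                           r = (mdist (f x) (f y) / mdist x y)%:E]).

Definition distortion {X Y : metricType R} (f : X -> Y) : \bar R :=
  if `[< injective f >] then Lip f * Lip (@image_inv X Y f) else +oo.

(* c_Y(X) *)
Definition min_distortion (Y X : metricType R) : \bar R :=
  ereal_inf [set distortion f | f in [set: X -> Y]].

(* c_1(X) *)
Definition c1 (X : metricType R) : \bar R := min_distortion (L1 R) X.

End Distortion.

(* Main.v *)
Require Import Defs.
From HB Require Import structures.
From mathcomp Require Import all_boot all_order all_algebra.
From mathcomp Require Import all_classical all_reals all_analysis.
From mathcomp Require Import measurable_realfun.
From mathcomp Require Import complex.
From mathcomp Require Import ring lra zify.
Set Implicit Arguments.
Unset Strict Implicit.
Unset Printing Implicit Defensive.
Import Order.TTheory GRing.Theory Num.Theory.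
Import numFieldNormedType.Exports.
Local Open Scope ring_scope.

(* Write m = p + 1 = 2^q. Pull the L1 metric back along f to the grid (1/m)L/L, a
   finite abelian group G. It has negative type, so its average over
   translations has nonpositive nontrivial Fourier coefficients. Hence if a
   weighted family of test shifts h_j satisfies sum_j w_j (1 - cos chi(h_j)) >= d
   for every nontrivial character chi, then d times the mean of |f(x) - f(y)| over
   pairs is at most the weighted sum of the mean increments of f along the h_j.
   The characters are given by dual vectors, nonzero ones of length at least N.
   Vectors with random signs and dyadic lengths sqrt(n) / (8 2^k N) detect the
   bounded ones, and dyadic fractions of the basis vectors of L detect the others,
   at a total length O(sqrt(n) / N).
   On the other side, half of the points of G are at distance at least a constant
   times n / r from 0, where r is the covering radius of the dual. If too many were
   closer, their character table, whose phases are inner products of short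
   vectors, would be approximated by a polynomial of low degree, of rank
   C(n + D, n) smaller than the number of rows; this contradicts the
   orthogonality of the characters. *)

(** * Negative type of the real line and of L_1 *)

Section NegativeType.
Context {R : realType} {I : finType}.

(* Induction on the number of positive a_i: subtracting the least positive
   value a from all positive a_i changes the form by a times a square. *)
Lemma min_psd (w a : I -> R) : (forall i, 0 <= a i) ->
  0 <= \sum_i \sum_j w i * w j * Num.min (a i) (a j).
Proof.
have [k] := ubnP #|[pred i | 0 < a i]|.
elim: k a => // k IH a; rewrite ltnS => ak a0.
have [i0 i0P|aP] := pickP [pred i | 0 < a i]; last first.
  rewrite big1// => i _; rewrite big1// => j _.
  have az l : a l = 0.
    by apply/eqP; rewrite eq_le a0 andbT leNgt; apply/negP => al; have := aP l; rewrite /= al.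
  by rewrite !az minxx mulr0.
pose i1 := [arg min_(i < i0 | 0 < a i) a i]%O.
have [i1P i1min] : 0 < a i1 /\ forall j, 0 < a j -> a i1 <= a j.
  by rewrite /i1; case: arg_minP.
pose b i := if 0 < a i then a i - a i1 else 0.
pose p i : R := if 0 < a i then 1 else 0.
have b0 i : 0 <= b i by rewrite /b; case: ifP => // ai; rewrite subr_ge0 i1min.
have minE i j : Num.min (a i) (a j) = a i1 * p i * p j + Num.min (b i) (b j).
  have z l : (0 < a l) = false -> a l = 0.
    by move=> al; apply/eqP; rewrite eq_le a0 andbT leNgt al.
  rewrite /p /b; case: ifPn => [ai|/negbTE ai]; case: ifPn => [aj|/negbTE aj].
  - rewrite !mulr1 addr_minr; congr Num.min; ring.
  - by rewrite (z j aj) !mulr0 !min_r ?add0r ?subr_ge0 ?i1min // ltW.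
  - by rewrite (z i ai) !mulr0 !mul0r !min_l ?add0r ?subr_ge0 ?i1min // ltW.
  - by rewrite (z i ai) (z j aj) !mulr0 !minxx addr0.
have -> : \sum_i \sum_j w i * w j * Num.min (a i) (a j) =
   a i1 * (\sum_i w i * p i) ^+ 2 + \sum_i \sum_j w i * w j * Num.min (b i) (b j).
  rewrite expr2 mulr_suml mulr_sumr -big_split; apply: eq_bigr => i _.
  rewrite !mulr_sumr -big_split; apply: eq_bigr => j _ /=.
  by rewrite minE; ring.
apply: addr_ge0; first by rewrite mulr_ge0 ?sqr_ge0 ?(ltW i1P).
apply: IH => //.
apply: leq_trans ak; apply/proper_card/properP; split.
  apply/fintype.subsetP => i; rewrite !inE /b; by case: ifP => //; rewrite ltxx.
by exists i1; rewrite !inE /b ?i1P// subrr ltxx.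
Qed.

(** After a shift to nonnegative values b, |b_i - b_j| = b_i + b_j - 2 min(b_i, b_j). The first two
    terms vanish because the weights sum to 0, and the kernel min is positive semidefinite. *)
Lemma real_negative_type (w a : I -> R) : \sum_i w i = 0 ->
  \sum_i \sum_j w i * w j * `|a i - a j| <= 0.
Proof.
move=> w0; pose M := \sum_i `|a i|; pose b i := a i + M.
have b0 i : 0 <= b i.
  rewrite /b /M (bigD1 i)//= addrA addr_ge0 ?sumr_ge0//.
  by have := ler_norm (- a i); rewrite normrN; lra.
have E i j : `|a i - a j| = b i + b j - 2 * Num.min (b i) (b j).
  rewrite (_ : a i - a j = b i - b j); last by rewrite /b; ring.
  by case: (leP (b i) (b j)) => h; [rewrite ler0_norm|rewrite gtr0_norm]; lra.
have -> : \sum_i \sum_j w i * w j * `|a i - a j| =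
  (\sum_i w i * b i) * (\sum_i w i) + (\sum_i w i) * (\sum_j w j * b j)
  - 2 * \sum_i \sum_j w i * w j * Num.min (b i) (b j).
  rewrite !mulr_suml mulr_sumr -big_split -sumrB; apply: eq_bigr => i _ /=.
  rewrite !mulr_sumr -big_split -sumrB; apply: eq_bigr => j _ /=.
  by rewrite E; ring.
rewrite w0 mul0r mulr0 !add0r oppr_le0 mulr_ge0//.
exact: min_psd.
Qed.

End NegativeType.

Section L1NegativeType.
Context {R : realType} {I : finType}.
Local Open Scope ereal_scope.

Lemma L1_dist_integral (f g : L1 R) : (L1_dist f g)%:E =
  \int[@lebesgue01 R]_x (`|L1_fun f x - L1_fun g x|%R)%:E.
Proof. by rewrite L1_distE Lnorm1. Qed.

Lemma integrable_L1_diff (f g : L1 R) : (@lebesgue01 R).-integrable setT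
  (fun x => (`|L1_fun f x - L1_fun g x|%R)%:E).
Proof.
apply/integrableP; split.
  apply/measurable_EFinP; apply: measurableT_comp => //.
  by apply: measurable_funB; exact: measurable_L1_fun.
under eq_integral do rewrite gee0_abs ?lee_fin//.
by rewrite -L1_dist_integral ltry.
Qed.

(** The form is the integral over x of the real form at the values [L1_fun (f i) x], each of which
    is nonpositive. *)
Lemma L1_negative_type (w : I -> R) (f : I -> L1 R) : (\sum_i w i = 0 ->
  \sum_i \sum_j w i * w j * mdist (f i) (f j) <= 0)%R.
Proof.
move=> w0; rewrite -lee_fin -sumEFin.
under eq_bigr => i _.
  rewrite -sumEFin.
  under eq_bigr => j _.
    rewrite EFinM [X in _ * X%:E](_ : _ = L1_dist (f i) (f j))//.
    rewrite L1_dist_integral -integralZl//; last exact: integrable_L1_diff.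
    over.
  rewrite -integral_sum//; last first.
    by move=> j; apply: integrableZl => //; exact: integrable_L1_diff.
  over.
rewrite /= -integral_sum//; last first.
  move=> i; apply: integrable_sum => // j _.
  by apply: integrableZl => //; exact: integrable_L1_diff.
apply: (@le_trans _ _ (\int[@lebesgue01 R]_x 0)); last by rewrite integral0.
apply: le_integral => //.
- apply: integrable_sum => // i _; apply: integrable_sum => // j _.
  by apply: integrableZl => //; exact: integrable_L1_diff.
- exact: integrable0.
- move=> x _.
  under eq_bigr => i _.
    under eq_bigr => j _ do rewrite -EFinM.
    rewrite sumEFin; over.
  by rewrite sumEFin lee_fin (real_negative_type (fun i => L1_fun (f i) x)).
Qed.

End L1NegativeType.

(** * Taylor estimates for sine and cosine *)

Section Taylor.
Local Open Scope classical_set_scope.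
Local Open Scope ring_scope.
Context {R : realType}.

Lemma expr_fact_geometric (X : R) (N j : nat) : 0 <= X -> 2 * X <= N%:R ->
  X ^+ (N + j) / (N + j)`!%:R <= X ^+ N / N`!%:R * 2^-1 ^+ j.
Proof.
move=> X0 XN; elim: j => [|j IH]; first by rewrite addn0 expr0 mulr1.
rewrite addnS exprS factS natrM invfM mulrACA exprS [leRHS]mulrCA.
apply: ler_pM => //; try by rewrite mulr_ge0 ?exprn_ge0.
rewrite ler_pdivrMr ?ltr0n// -[(N + j).+1%:R]natr1 natrD; have : 0 <= j%:R :> R by [].
by lra.
Qed.

Lemma geometric_half_le M : \sum_(j < M) 2^-1 ^+ j <= 2 :> R.
Proof.
suff : \sum_(j < M) 2^-1 ^+ j + 2 * 2^-1 ^+ M <= 2 :> R.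
  by have : 0 <= 2^-1 ^+ M :> R by []; lra.
elim: M => [|M IH]; first by rewrite big_ord0 expr0; lra.
by rewrite big_ord_recr/= exprS; lra.
Qed.

(** From index N on, consecutive terms of X^k / k! have ratio at most 1/2, so the tail is at most
    twice its first term. *)
Lemma series_tail_le (a : R^nat) (l X : R) (N : nat) :
  series a @ \oo --> l -> 0 <= X -> 2 * X <= N%:R ->
  (forall k, `|a k| <= X ^+ k / k`!%:R) ->
  `|l - \sum_(k < N) a k| <= 2 * (X ^+ N / N`!%:R).
Proof.
move=> al X0 XN aX.
have tail M : (N <= M)%N ->
    `|series a M - \sum_(k < N) a k| <= 2 * (X ^+ N / N`!%:R).
  move=> /subnKC <-; rewrite /series/= big_mkord big_split_ord/= addrAC subrr add0r.
  rewrite (le_trans (ler_norm_sum _ _ _))//.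
  apply: (@le_trans _ _ (\sum_(j < M - N) X ^+ N / N`!%:R * 2^-1 ^+ j)).
    by apply: ler_sum => j _; rewrite (le_trans (aX _))// expr_fact_geometric.
  by rewrite -mulr_sumr mulrC ler_wpM2r ?geometric_half_le// mulr_ge0// exprn_ge0.
have cv : (fun M => `|series a M - \sum_(k < N) a k|) @ \oo -->
    `|l - \sum_(k < N) a k|.
  by apply: cvg_norm; apply: cvgB => //; exact: cvg_cst.
rewrite -(cvg_lim _ cv)//; apply: limr_le; first by apply/cvg_ex; eexists; exact: cv.
by exists N => // M /=; exact: tail.
Qed.

Lemma cos_taylor (x X : R) N : `|x| <= X -> 2 * X <= N%:R ->
  `|cos x - \sum_(k < N) cos_coeff x k| <= 2 * (X ^+ N / N`!%:R).
Proof.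
move=> xX XN; apply: series_tail_le XN _ => //.
- by rewrite unlock; exact: is_cvg_series_cos_coeff.
- exact: le_trans xX.
move=> k; rewrite /cos_coeff /= !normrM normfV !normr_nat !normrX normrN normr1.
rewrite expr1n mulr1 ler_wpM2r//.
by case: odd; rewrite ?mul0r ?mul1r ?exprn_ge0 ?(le_trans _ xX)// lerXn2r ?nnegrE ?(le_trans _ xX).
Qed.

Lemma sin_taylor (x X : R) N : `|x| <= X -> 2 * X <= N%:R ->
  `|sin x - \sum_(k < N) sin_coeff x k| <= 2 * (X ^+ N / N`!%:R).
Proof.
move=> xX XN; apply: series_tail_le XN _ => //.
- by rewrite unlock; exact: is_cvg_series_sin_coeff.
- exact: le_trans xX.
move=> k; rewrite /sin_coeff /= !normrM normfV !normr_nat !normrX normrN normr1.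
rewrite expr1n mulr1 ler_wpM2r//.
by case: odd; rewrite ?mul0r ?mul1r ?exprn_ge0 ?(le_trans _ xX)// lerXn2r ?nnegrE ?(le_trans _ xX).
Qed.

(** Four Taylor terms give 1 - x^2/2 with error at most x^4/12, hence at most x^2/12. *)
Lemma cos_le_quadratic (x : R) : `|x| <= 1 -> cos x <= 1 - x ^+ 2 / 4.
Proof.
move=> x1; have := @cos_taylor x `|x| 4 (lexx _).
have -> : 2 * `|x| <= 4%:R by lra.
move=> /(_ isT).
rewrite !big_ord_recr big_ord0 /cos_coeff /= ?factS fact0 -normrX.
rewrite !mul0r !mul1r !muln1 !addr0 ?add0r ?expr1z ?mulN1r invr1.
have x40 : 0 <= x ^+ 4 by rewrite (_ : 4 = 2 * 2)%N// exprM sqr_ge0.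
rewrite (ger0_norm x40).
have : x ^+ 4 <= x ^+ 2.
  rewrite (_ : 4 = 2 + 2)%N// exprD ler_piMr ?sqr_ge0//.
  by rewrite -real_normK ?num_real// expr_le1.
rewrite ler_norml => h /andP[_]; have := sqr_ge0 x.
move: h; set y := x ^+ 2; set z := x ^+ 4; lra.
Qed.

(** One Taylor term bounds both |cos h - 1| and |sin h| by 2|h|; the addition formula does the
    rest. *)
Lemma cos_perturb (b h : R) : `|h| <= 1 / 2 -> `|cos (b + h) - cos b| <= 4 * `|h|.
Proof.
move=> h2; have XN : 2 * `|h| <= 1%:R by lra.
have := cos_taylor (lexx _) XN; have := sin_taylor (lexx _) XN.
rewrite !big_ord1 /sin_coeff /cos_coeff /= !mul0r subr0 !mul1r expr1 divr1 => s c.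
have -> : cos (b + h) - cos b = cos b * (cos h - 1) - sin b * sin h.
  by rewrite cosD; ring.
rewrite (le_trans (ler_normB _ _))// !normrM.
have := ler_wpM2r (normr_ge0 (cos h - 1)) (cos_max b).
have := ler_wpM2r (normr_ge0 (sin h)) (sin_max b).
by move: c; rewrite fact0 invr1; lra.
Qed.

End Taylor.

(** * A Poincare inequality on a finite abelian group *)

Section Poincare.
Context {R : realType} {G : finZmodType} {V : finType}.
(** [c v] and [s v] are the real and imaginary parts of the character of index [v], and [v0] is the
    index of the trivial one. The hypotheses on sums are the orthogonality relations. *)
Variables (c s : V -> G -> R) (v0 : V).
Hypothesis cB : forall v x y, c v (x - y) = c v x * c v y + s v x * s v y.
Hypothesis c0 : forall v, c v 0 = 1.
Hypothesis cN : forall v x, c v (- x) = c v x.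
Hypothesis sN : forall v x, s v (- x) = - s v x.
Hypothesis c_trivial : forall x, c v0 x = 1.
Hypothesis sum_cV : forall x, \sum_v c v x = (x == 0)%:R * #|V|%:R.
Hypothesis sum_cG : forall v, v != v0 -> \sum_x c v x = 0.
Hypothesis sum_sG : forall v, v != v0 -> \sum_x s v x = 0.
Variable D : G -> G -> R.
Hypothesis D0 : forall x, D x x = 0.
Hypothesis DC : forall x y, D x y = D y x.
Hypothesis D_negative_type : forall w : G -> R, \sum_i w i = 0 ->
  \sum_i \sum_j w i * w j * D i j <= 0.

Definition shift_sum (h : G) : R := \sum_x D x (x + h).

(** The Fourier coefficients of [shift_sum]; this function is even, so its sine coefficients
    vanish. *)
Let S v := \sum_h shift_sum h * c v h.

Let rhoN h : shift_sum (- h) = shift_sum h.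
Proof.
rewrite /shift_sum (reindex_inj (addIr h)); apply: eq_bigr => x _ /=.
by rewrite addrK DC.
Qed.

(** Writing h as a difference of two points and expanding the cosine makes S v the sum of two
    quadratic forms of D, with weights [c v] and [s v]. Both weights sum to 0 for a nontrivial
    character, so negative type applies. *)
Let S_le0 v : v != v0 -> S v <= 0.
Proof.
move=> vN0; have -> : S v = \sum_i \sum_j c v i * c v j * D i j +
                            \sum_i \sum_j s v i * s v j * D i j.
  rewrite /S /shift_sum -big_split/=.
  under eq_bigr => h _ do rewrite mulr_suml.
  rewrite exchange_big/=; apply: eq_bigr => x _; rewrite -big_split/=.
  rewrite [RHS](reindex_inj (addrI x)); apply: eq_bigr => h _ /=.
  by rewrite -mulrDl -cB opprD addrA subrr add0r cN mulrC.
rewrite -[leRHS]addr0; apply: lerD.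
- exact: D_negative_type (sum_cG vN0).
- exact: D_negative_type (sum_sG vN0).
Qed.

Let inversion h : #|V|%:R * shift_sum h = \sum_v S v * c v h.
Proof.
have T0 v : \sum_k shift_sum k * s v k = 0.
  suff : \sum_k shift_sum k * s v k = - \sum_k shift_sum k * s v k by lra.
  rewrite {1}(reindex_inj oppr_inj)/= -sumrN; apply: eq_bigr => k _.
  by rewrite rhoN sN mulrN.
have -> : \sum_v S v * c v h = \sum_k shift_sum k * \sum_v c v (h - k).
  transitivity (\sum_v \sum_k shift_sum k * c v (h - k)); last first.
    by rewrite exchange_big; apply: eq_bigr => k _; rewrite mulr_sumr.
  apply: eq_bigr => v _; transitivity
    ((\sum_k shift_sum k * c v k) * c v h + (\sum_k shift_sum k * s v k) * s v h).
    by rewrite T0 mul0r addr0.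
  rewrite !mulr_suml -big_split; apply: eq_bigr => k _ /=.
  by rewrite cB; ring.
rewrite (bigD1 h)//= sum_cV subrr eqxx mul1r mulrC big1 ?addr0// => k kh.
by rewrite sum_cV subr_eq0 eq_sym (negbTE kh) mul0r mulr0.
Qed.

(* On the Fourier side negative type says S v <= 0 for v <> v0, and
   shift_sum 0 = 0 says that the S v sum to 0. *)
Lemma poincare (J : finType) (w : J -> R) (g : J -> G) (d : R) :
  (forall v, v != v0 -> d <= \sum_j w j * (1 - c v (g j))) ->
  d * \sum_h shift_sum h <= #|V|%:R * \sum_j w j * shift_sum (g j).
Proof.
move=> gap.
have S0 : \sum_v S v = 0.
  have := inversion 0; rewrite {1}/shift_sum big1 ?mulr0; last first.
    by move=> x _; rewrite addr0 D0.
  by move=> e; rewrite [RHS]e; apply: eq_bigr => v _; rewrite c0 mulr1.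
have Sv0 : \sum_h shift_sum h = S v0.
  by apply: eq_bigr => h _; rewrite c_trivial mulr1.
have -> : #|V|%:R * \sum_j w j * shift_sum (g j) =
    - \sum_v S v * \sum_j w j * (1 - c v (g j)).
  rewrite mulr_sumr -sumrN.
  under eq_bigr => j _ do rewrite mulrCA inversion.
  under [RHS]eq_bigr => v _ do rewrite mulr_sumr -sumrN.
  rewrite [RHS]exchange_big/=; apply: eq_bigr => j _.
  (* As the S v sum to 0, the constant 1 of 1 - c can be inserted freely. *)
  transitivity (w j * \sum_v S v * c v (g j) - w j * \sum_v S v).
    by rewrite S0 mulr0 subr0.
  rewrite -mulrBr -sumrB mulr_sumr; apply: eq_bigr => v _.
  by ring.
rewrite (bigD1 v0)//= [X in S v0 * X]big1 ?mulr0 ?add0r; last first.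
  by move=> j _; rewrite c_trivial subrr mulr0.
rewrite Sv0; have -> : S v0 = - \sum_(v | v != v0) S v.
  by move: S0; rewrite (bigD1 v0)//= => /eqP; rewrite addr_eq0 => /eqP.
rewrite mulrN lerN2 mulr_sumr; apply: ler_sum => v vN0.
by rewrite [leRHS]mulrC ler_wnM2l ?S_le0// gap.
Qed.

End Poincare.

(** * Characters of the group (Z/m)^n *)

Section Circle.
Context {R : realType}.
Implicit Types t z : R.

Definition cos2pi t : R := cos (2 * pi * t).
Definition sin2pi t : R := sin (2 * pi * t).

Lemma cos_sin2piDint t z : z \is a Num.int ->
  cos2pi (t + z) = cos2pi t /\ sin2pi (t + z) = sin2pi t.
Proof.
have natE (k : nat) u : cos2pi (u + k%:R) = cos2pi u /\ sin2pi (u + k%:R) = sin2pi u.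
  rewrite /cos2pi /sin2pi mulrDr (_ : 2 * pi * k%:R = (pi *+ 2) *+ k); last first.
    by rewrite -[in RHS]mulr_natl -(mulr_natl pi); ring.
  split; last exact: (periodicn (@sinD2pi R)).
  exact: (periodicn (@cosD2pi R)).
rewrite intrE => /orP[/natrP[k ->]|/natrP[k zk]]; first exact: natE.
have -> : z = - k%:R by rewrite -zk opprK.
by have [<- <-] := natE k (t - k%:R); rewrite subrK.
Qed.

Lemma cos2piD t z : cos2pi (t + z) = cos2pi t * cos2pi z - sin2pi t * sin2pi z.
Proof. by rewrite /cos2pi mulrDr cosD. Qed.

Lemma sin2piD t z : sin2pi (t + z) = sin2pi t * cos2pi z + cos2pi t * sin2pi z.
Proof. by rewrite /sin2pi mulrDr sinD. Qed.

Lemma cos2piN t : cos2pi (- t) = cos2pi t.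
Proof. by rewrite /cos2pi mulrN cosN. Qed.

Lemma sin2piN t : sin2pi (- t) = - sin2pi t.
Proof. by rewrite /sin2pi mulrN sinN. Qed.

Lemma cos2pi0 : cos2pi 0 = 1.
Proof. by rewrite /cos2pi mulr0 cos0. Qed.

Lemma cos2pi_double t : cos2pi t = 1 - 2 * sin (pi * t) ^+ 2.
Proof.
rewrite /cos2pi (_ : 2 * pi * t = (pi * t) *+ 2); last by rewrite -[RHS]mulr_natl; ring.
by rewrite cos_mulr2n cos2sin2 -mulr_natl; ring.
Qed.

Lemma cos2pi_lt1 t : 0 < t < 1 -> cos2pi t < 1.
Proof.
move=> /andP[t0 t1]; rewrite cos2pi_double ltrBlDr ltrDl mulr_gt0// exprn_gt0//.
by apply: sin_gt0_pi; rewrite mulr_gt0 ?pi_gt0//= -[ltRHS]mulr1 ltr_pM2l ?pi_gt0.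
Qed.

End Circle.

Section Characters.
Context {R : realType} {n p : nat}.
Let G := 'rV['I_p.+1]_n.
Implicit Types (x y v : G) (a b : 'rV[R]_n).

(** Residues mod m are lifted to 0, ..., m - 1, so this map is additive only up to m times an
    integer vector. *)
Definition coords x : 'rV[R]_n := \row_i (x 0 i)%:R.

Definition intvec a : Prop := forall i, a 0 i \is a Num.int.

Lemma intvec_coords x : intvec (coords x).
Proof. by move=> i; rewrite mxE natr_int. Qed.

Lemma dotv_int a b : intvec a -> intvec b -> dotv a b \is a Num.int.
Proof. by move=> ia ib; apply: rpred_sum => i _; rewrite rpredM. Qed.

Lemma coordsD x y : exists2 z, intvec z &
  coords (x + y) = coords x + coords y + p.+1%:R *: z.
Proof.
exists (\row_i - ((x 0 i + y 0 i) %/ p.+1)%:R).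
  by move=> i; rewrite mxE rpredN natr_int.
apply/rowP => i; rewrite !mxE /=.
by rewrite -natrD {2}(divn_eq (x 0 i + y 0 i) p.+1) natrD natrM; ring.
Qed.

Lemma coordsN x : exists2 z, intvec z & coords (- x) = - coords x + p.+1%:R *: z.
Proof.
(* The quotient is 1 when the entry is 0, where m - 0 is reduced to 0, and 0 otherwise. *)
exists (\row_i (1 - ((p.+1 - x 0 i) %/ p.+1)%:R)).
  by move=> i; rewrite mxE; apply: rpredB; [exact: rpred1|exact: natr_int].
apply/rowP => i; rewrite !mxE /=.
have e : (p.+1 - x 0 i)%:R = p.+1%:R - (x 0 i)%:R :> R by rewrite natrB// ltnW.
have : ((p.+1 - x 0 i) %% p.+1)%:R = p.+1%:R - (x 0 i)%:R
    - ((p.+1 - x 0 i) %/ p.+1)%:R * p.+1%:R :> R.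
  by rewrite -e {2}(divn_eq (p.+1 - x 0 i) p.+1) natrD natrM addrAC subrr add0r.
by move=> ->; ring.
Qed.

Lemma coords0 : coords 0 = 0.
Proof. by apply/rowP => i; rewrite !mxE. Qed.

Definition phase v x : R := dotv (coords v) (coords x) / p.+1%:R.

Lemma phaseC v x : phase v x = phase x v.
Proof. by rewrite /phase dotvC. Qed.

Let m0 : p.+1%:R != 0 :> R. Proof. by rewrite pnatr_eq0. Qed.

Lemma phaseD v x y : exists2 z, z \is a Num.int & 
  phase v (x + y) = phase v x + phase v y + z.
Proof.
have [z iz e] := coordsD x y; exists (dotv (coords v) z).
  by apply: dotv_int => //; exact: intvec_coords.
by rewrite /phase e !dotvDr dotvZr -[in RHS](mulfK m0 (dotv (coords v) z)); ring.
Qed.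

Lemma phaseN v x : exists2 z, z \is a Num.int & phase v (- x) = - phase v x + z.
Proof.
have [z iz e] := coordsN x; exists (dotv (coords v) z).
  by apply: dotv_int => //; exact: intvec_coords.
by rewrite /phase e !dotvDr -scaleN1r !dotvZr -[in RHS](mulfK m0 (dotv (coords v) z)); ring.
Qed.

(* Real and imaginary part of the character of index v. *)
Definition chc v x : R := cos2pi (phase v x).
Definition chs v x : R := sin2pi (phase v x).

Lemma chcN v x : chc v (- x) = chc v x.
Proof.
rewrite /chc; have [z iz ->] := phaseN v x.
by have [-> _] := cos_sin2piDint (- phase v x) iz; rewrite cos2piN.
Qed.

Lemma chsN v x : chs v (- x) = - chs v x.
Proof.
rewrite /chs; have [z iz ->] := phaseN v x.
by have [_ ->] := cos_sin2piDint (- phase v x) iz; rewrite sin2piN.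
Qed.

Lemma chcD v x y : chc v (x + y) = chc v x * chc v y - chs v x * chs v y.
Proof.
rewrite /chc /chs; have [z iz ->] := phaseD v x y.
by have [-> _] := cos_sin2piDint (phase v x + phase v y) iz; rewrite cos2piD.
Qed.

Lemma chsD v x y : chs v (x + y) = chs v x * chc v y + chc v x * chs v y.
Proof.
rewrite /chc /chs; have [z iz ->] := phaseD v x y.
by have [_ ->] := cos_sin2piDint (phase v x + phase v y) iz; rewrite sin2piD.
Qed.

Lemma chcB v x y : chc v (x - y) = chc v x * chc v y + chs v x * chs v y.
Proof. by rewrite chcD chcN chsN mulrN opprK. Qed.

Lemma chc0 v : chc v 0 = 1.
Proof. by rewrite /chc /phase coords0 -(scale0r 0) dotvZr !mul0r cos2pi0. Qed.

Lemma chcC v x : chc v x = chc x v. Proof. by rewrite /chc phaseC. Qed.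
Lemma chsC v x : chs v x = chs x v. Proof. by rewrite /chs phaseC. Qed.

(** Translation by a unit vector d in a coordinate where v is nonzero multiplies the character sum
    by chi(d), which differs from 1. *)
Lemma sum_ch v : v != 0 -> \sum_x chc v x = 0 /\ \sum_x chs v x = 0.
Proof.
move=> v0; have [i vi0] : exists i, v 0 i != 0.
  apply/existsP; apply: contraNT v0 => /existsPn v0; apply/eqP/rowP => i.
  by rewrite mxE; apply/eqP; rewrite -[_ == _]negbK v0.
have vi : (0 < v 0%R i)%N by rewrite lt0n; apply: contraNneq vi0 => h; apply/eqP/val_inj.
have p0 : (0 < p)%N by apply: leq_trans vi _; rewrite -ltnS.
pose d : G := \row_j if j == i then inZp 1 else 0.
have C1 : chc v d < 1.
  have -> : chc v d = cos2pi ((v 0 i)%:R / p.+1%:R).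
    rewrite /chc /phase /dotv (bigD1 i)//= !mxE eqxx /= modn_small ?ltnS// mulr1.
    by rewrite big1 ?addr0// => j /negbTE ji; rewrite !mxE ji mulr0.
  by apply: cos2pi_lt1; rewrite divr_gt0 ?ltr0n//= ltr_pdivrMr ?ltr0n// mul1r ltr_nat.
have := cos2Dsin2 (2 * pi * phase v d); rewrite -/(cos2pi _) -/(sin2pi _).
rewrite -/(chc v d) -/(chs v d).
have : \sum_x chc v x = (\sum_x chc v x) * chc v d - (\sum_x chs v x) * chs v d.
  rewrite {1}(reindex_inj (addIr d))/= !mulr_suml -sumrB.
  by apply: eq_bigr => x _; rewrite chcD.
have : \sum_x chs v x = (\sum_x chs v x) * chc v d + (\sum_x chc v x) * chs v d.
  rewrite {1}(reindex_inj (addIr d))/= !mulr_suml -big_split/=.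
  by apply: eq_bigr => x _; rewrite chsD.
move: C1; set a := chc v d; set b := chs v d; set S := \sum_x chs v x; set C := \sum_x chc v x.
move=> a1 SE CE ab.
(* 2 (1 - a) is the squared modulus of 1 - chi(d). The real linear system for C and S is solved by
   multiplying with the conjugate. *)
have aN0 : 2 * (1 - a) != 0 by rewrite mulf_neq0// subr_eq0 gt_eqF.
have abE : 2 * (1 - a) = (1 - a) ^+ 2 + b ^+ 2.
  by rewrite sqrrB expr1n; move: ab; set a2 := a ^+ 2; set b2 := b ^+ 2; lra.
have CE' : C * (1 - a) = - S * b by rewrite mulrBr mulr1 {1}CE; ring.
have SE' : S * (1 - a) = C * b by rewrite mulrBr mulr1 {1}SE; ring.
split; apply: (mulIf aN0); rewrite mul0r abE.
  transitivity (C * (1 - a) * (1 - a) + C * b * b); first by ring.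
  by rewrite CE' -SE'; ring.
transitivity (S * (1 - a) * (1 - a) + S * b * b); first by ring.
rewrite SE' (_ : S * b = - (C * (1 - a))); last by rewrite CE'; ring.
by ring.
Qed.

Lemma sum_chc v : \sum_x chc v x = (v == 0)%:R * #|{: G}|%:R.
Proof.
have [->|v0] := eqVneq v 0; last by rewrite (sum_ch v0).1 mul0r.
by under eq_bigr => x _ do rewrite chcC chc0; rewrite sumr_const mul1r.
Qed.

End Characters.

(** * Approximate rank and the rank of low-degree kernels *)

Section ApproximateRank.
Context {R : realType}.

(* A matrix that is entrywise closer to M than the scale set by the
   orthogonality of the rows of M has independent rows as well. *)
Lemma approximate_rank (V : finType) (h k : nat) (M : 'I_h -> V -> R)
    (A : 'I_h -> 'I_k -> R) (B : 'I_k -> V -> R) (N e : R) :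
  (forall i j, \sum_v M i v * M j v = (i == j)%:R * N) ->
  (forall i v, `|M i v - \sum_l A i l * B l v| <= e) ->
  #|V|%:R * h%:R * e ^+ 2 < N -> (h <= k)%N.
Proof.
move=> MO Me VN; rewrite leqNgt; apply/negP => kh.
pose X : 'M[R]_(h, k) := \matrix_(i, l) A i l.
(* With more rows than columns, the left factor has a nonzero vector a in its left kernel. *)
have [a aX a0] : exists2 a : 'rV[R]_h, a *m X = 0 & a != 0.
  have : kermx X != 0.
    rewrite kermx_eq0 /row_free neq_ltn; apply/orP; left.
    by apply: leq_ltn_trans kh; exact: rank_leq_col.
  by move=> /rowV0Pn[a /sub_kermxP aX a0]; exists a.
have a2 : 0 < dotv a a.
  rewrite lt_neqAle dotv_ge0 andbT eq_sym.
  by apply: contraNneq a0 => /dotv_eq0 ->.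
have e0 i v : (M i v - \sum_l A i l * B l v) ^+ 2 <= e ^+ 2.
  by rewrite -real_normK ?num_real// lerXn2r ?nnegrE// (le_trans _ (Me i v)).
have kill v : \sum_i a 0 i * \sum_l A i l * B l v = 0.
  under eq_bigr => i _ do rewrite mulr_sumr.
  rewrite exchange_big big1// => l _.
  under eq_bigr => i _ do rewrite mulrA.
  rewrite -mulr_suml; move/rowP/(_ l) : aX; rewrite !mxE => aX.
  rewrite (eq_bigr (fun i => a 0 i * X i l)) ?aX ?mul0r// => i _.
  by rewrite mxE.
(* The left side is the squared norm of aM, by orthogonality of the rows. Since a kills the
   approximation, only the errors remain in aM, and Cauchy-Schwarz bounds each entry. *)
have : N * dotv a a <= #|V|%:R * (dotv a a * (h%:R * e ^+ 2)).
  have -> : N * dotv a a = \sum_v (\sum_i a 0 i * M i v) ^+ 2.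
    under [RHS]eq_bigr => v _.
      rewrite expr2 mulr_suml.
      under eq_bigr => i _ do rewrite mulr_sumr.
      over.
    rewrite exchange_big mulr_sumr; apply: eq_bigr => i _ /=.
    rewrite exchange_big/= (bigD1 i)//= [X in _ + X]big1 => [|j ji].
      rewrite addr0; under eq_bigr => v _ do rewrite mulrACA.
      by rewrite -mulr_sumr MO eqxx mul1r mulrC.
    under eq_bigr => v _ do rewrite mulrACA.
    by rewrite -mulr_sumr MO eq_sym (negbTE ji) mul0r mulr0.
  rewrite mulr_natl -sumr_const; apply: ler_sum => v _.
  pose d : 'rV[R]_h := \row_i (M i v - \sum_l A i l * B l v).
  have -> : \sum_i a 0 i * M i v = dotv a d.
    transitivity (\sum_i a 0 i * M i v - \sum_i a 0 i * \sum_l A i l * B l v).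
      by rewrite kill subr0.
    rewrite -sumrB; apply: eq_bigr => i _.
    by rewrite mxE mulrBr.
  rewrite (le_trans (dotv_cauchy _ _))// ler_wpM2l ?dotv_ge0//.
  rewrite mulr_natl -[h in leRHS]card_ord -sumr_const; apply: ler_sum => i _.
  by rewrite mxE -expr2.
by rewrite mulrCA [leRHS]mulrC ler_pM2r// mulrA leNgt => /negP; apply.
Qed.

End ApproximateRank.
Section PolynomialKernel.
Context {R : realType}.

(** The power expands into a sum over the functions f from d factors to n variables. Grouping them
    by their multiplicities [cnt f] gives multinomial coefficients. *)
Lemma expr_sum_monomials (n D d : nat) : (d <= D)%N ->
  exists c : n.-tuple 'I_D.+1 -> R, forall x : 'I_n -> R,
    (\sum_i x i) ^+ d =
    \sum_(t in [set t : n.-tuple 'I_D.+1 | (\sum_(i <- t) i <= D)%N])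
      c t * \prod_i x i ^+ tnth t i.
Proof.
move=> dD; pose num (f : {ffun 'I_d -> 'I_n}) i := #|[pred j | f j == i]|.
pose cnt f : n.-tuple 'I_D.+1 := [tuple inord (num f i) | i < n].
have cntE f i : tnth (cnt f) i = num f i :> nat.
  rewrite tnth_mktuple inordK// ltnS (leq_trans _ dD)//.
  by rewrite -[leqRHS]card_ord max_card.
exists (fun t => (#|[pred f | cnt f == t]|)%:R) => x.
rewrite -[d in LHS]card_ord -prodr_const bigA_distr_bigA/=.
rewrite (partition_big cnt
  (mem [set t : n.-tuple 'I_D.+1 | (\sum_(i <- t) i <= D)%N]))/=; last first.
  move=> f _; rewrite !inE big_tuple.
  under eq_bigr => i _ do rewrite cntE.
  rewrite (leq_trans _ dD)// -[leqRHS]card_ord -sum1_card (partition_big f xpredT)//=.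
  by apply: leq_sum => i _; rewrite sum1_card.
apply: eq_bigr => t _; rewrite mulr_natl -sumr_const.
apply: eq_big => [f|f /eqP <-]; first by rewrite inE.
rewrite (partition_big f xpredT)//=; apply: eq_bigr => i _.
rewrite cntE -prodr_const; apply: eq_big => [j|j /eqP -> //].
by rewrite inE.
Qed.

Lemma poly_sum_monomials (n D : nat) (a : nat -> R) :
  exists c : n.-tuple 'I_D.+1 -> R, forall x : 'I_n -> R,
    \sum_(d < D.+1) a d * (\sum_i x i) ^+ d =
    \sum_(t in [set t : n.-tuple 'I_D.+1 | (\sum_(i <- t) i <= D)%N])
      c t * \prod_i x i ^+ tnth t i.
Proof.
have /choice[c cP] : forall d : 'I_D.+1, exists c : n.-tuple 'I_D.+1 -> R,
    forall x : 'I_n -> R, (\sum_i x i) ^+ d =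
    \sum_(t in [set t : n.-tuple 'I_D.+1 | (\sum_(i <- t) i <= D)%N])
      c t * \prod_i x i ^+ tnth t i.
  by move=> d; apply: expr_sum_monomials; rewrite -ltnS.
exists (fun t => \sum_(d < D.+1) a d * c d t) => x.
under eq_bigr => d _ do rewrite cP mulr_sumr.
rewrite exchange_big; apply: eq_bigr => t _; rewrite mulr_suml.
by apply: eq_bigr => d _; rewrite mulrA.
Qed.

(** Each monomial in the products u_i w_i is a monomial in u times one in w, and there are C(n + D,
    n) exponent vectors of total degree at most D. *)
Lemma poly_kernel_rank (n D : nat) (a : nat -> R) : exists k (f g : 'I_k -> 'rV[R]_n -> R),
  k = 'C(n + D, n) /\ forall u w,
  \sum_(d < D.+1) a d * dotv u w ^+ d = \sum_l f l u * g l w.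
Proof.
have [c cP] := poly_sum_monomials n D a.
pose T := [set t : n.-tuple 'I_D.+1 | (\sum_(i <- t) i <= D)%N].
pose mono (l : 'I_#|T|) (u : 'rV[R]_n) := \prod_i u 0 i ^+ tnth (enum_val l) i.
exists #|T|, (fun l u => c (enum_val l) * mono l u), mono.
split; first exact: card_partial_ord_partitions.
move=> u w; rewrite cP big_enum_val /=; apply: eq_bigr => l _.
by rewrite -mulrA -big_split/=; congr (_ * _); apply: eq_bigr => i _; rewrite exprMn.
Qed.

End PolynomialKernel.

(** * Numerical estimates for binomials and factorials *)

Section Counting.
Implicit Types a k t n : nat.

Lemma leq_ffact_exp a k : (a ^_ k <= a ^ k)%N.
Proof.
elim: k a => [|k IH] a; first by rewrite ffactn0.
case: a => [|a]; first by rewrite ffact0n.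
rewrite ffactSS expnS leq_mul2l /= (leq_trans (IH a))//.
by case: k {IH} => // k; rewrite leq_exp2r.
Qed.

Lemma leq_exp_ffact a k : (a ^ k <= (a + k) ^_ k)%N.
Proof.
elim: k => [|k IH]; first by rewrite ffactn0.
by rewrite addnS ffactSS expnS leq_mul// leqW// leq_addr.
Qed.

(** k^k is at most the falling factorial (2k)_k = C(2k, k) k!, and C(2k, k) is at most 2^(2k). *)
Lemma expn_self_fact k : (k ^ k <= 4 ^ k * k`!)%N.
Proof.
rewrite (leq_trans (leq_exp_ffact k k))// -bin_ffact leq_mul2r; apply/orP; right.
rewrite (_ : 4 = 2 ^ 2)%N// -expnM mul2n -addnn.
have := expnDn 1 1 (k + k); rewrite [(1 + 1)%N]/= => ->.
have kk : (k < (k + k).+1)%N by rewrite ltnS leq_addr.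
by rewrite (bigD1 (Ordinal kk))//= !exp1n !muln1 leq_addr.
Qed.

(** Times n!, the binomial is at most (n (t + 1))^n, where n^n <= 4^n n! and 4 (t + 1) <= 8 t. *)
Lemma bin_monomials_le n t : (0 < n)%N -> (0 < t)%N ->
  ('C(n + (n * t).-1, n) <= (8 * t) ^ n)%N.
Proof.
move=> n0 t0; rewrite -(@leq_pmul2r n`!) ?fact_gt0// bin_ffact.
rewrite (leq_trans (leq_ffact_exp _ _))//.
apply: (@leq_trans ((n * t.+1) ^ n)).
  by rewrite leq_exp2r// mulnS leq_add2l leq_pred.
rewrite expnMn (leq_trans (leq_mul (expn_self_fact n) (leqnn _)))//.
rewrite mulnAC leq_mul2r; apply/orP; right.
rewrite -expnMn leq_exp2r//; lia.
Qed.

(** The size condition of [approximate_rank] for at most m^n rows, m = 16 t, and entrywise error 4 /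
    64^(n t). *)
Lemma grid_lt_error n t : (0 < n)%N -> (0 < t)%N ->
  ((16 * t) ^ n * 4 ^ 2 < 64 ^ (n * t * 2))%N.
Proof.
move=> n0 t0; apply: (@leq_ltn_trans ((256 * t) ^ n)).
  rewrite (_ : 256 = 16 * 16)%N// -mulnA [leqRHS]expnMn mulnC leq_mul2r.
  by apply/orP; right; rewrite (@leq_trans (16 ^ 1))// leq_exp2l.
rewrite (mulnC n) -mulnA (mulnC n) mulnA expnM ltn_exp2r// (mulnC t) expnM.
rewrite (_ : 64 ^ 2 = 2048 * 2)%N// expnMn.
apply: (@leq_trans (2048 * 2 ^ t)).
  by have := ltn_expl t (isT : 1 < 2)%N; lia.
by rewrite leq_mul// (@leq_trans (2048 ^ 1))// leq_exp2l.
Qed.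

End Counting.

(** * Few grid points are close to the lattice *)

Section ShortPoints.
Context {R : realType}.

Lemma expr_fact_le (X : R) N : 0 <= X -> X * 256 <= N%:R ->
  X ^+ N / N`!%:R <= 64^-1 ^+ N.
Proof.
move=> X0 XN; rewrite ler_pdivrMr ?ltr0n ?fact_gt0//.
have : (N%:R : R) ^+ N <= 4 ^+ N * N`!%:R.
  by rewrite -!natrX -natrM ler_nat expn_self_fact.
have : X ^+ N <= (256^-1 * N%:R) ^+ N.
  by rewrite lerXn2r ?nnegrE//; lra.
move=> h1 h2; rewrite (le_trans h1)// exprMn.
rewrite (_ : 64^-1 = 256^-1 * 4 :> R); last by field.
by rewrite exprMn -mulrA ler_wpM2l// exprn_ge0.
Qed.

End ShortPoints.

Section TorusGrid.
Context {R : realType} {n p : nat} (L : lattice R n) (B : 'M[R]_n).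
Hypothesis Bu : B \in unitmx.
Hypothesis LE : lattice_set L =
  [set map_mx intr k *m B | k in [set: 'rV[int]_n]]%classic.
Let G := 'rV['I_p.+1]_n.
Implicit Types (x y v : G) (a b u w : 'rV[R]_n).

Lemma mem_lattice a : intvec a -> lattice_set L (a *m B).
Proof.
move=> ia; rewrite LE; exists (\row_i Num.floor (a 0 i)) => //; congr (_ *m _).
by apply/rowP => i; rewrite !mxE floorK ?ia.
Qed.

Lemma latticeE a : lattice_set L a -> exists2 z, intvec z & a = z *m B.
Proof.
rewrite LE => -[k _ <-]; exists (map_mx intr k) => // i.
by rewrite mxE intr_int.
Qed.

(** The rows of [(invmx B)^T] form the basis dual to the rows of B. *)
Lemma dotv_dual a b : dotv (a *m (invmx B)^T) (b *m B) = dotv a b.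
Proof.
have dotvE u w : dotv u w = (u *m w^T) 0 0.
  by rewrite mxE; apply: eq_bigr => i _; rewrite mxE.
by rewrite !dotvE trmx_mul mulmxA -(mulmxA a) -trmx_mul mulmxV// trmx1 mulmx1.
Qed.

Lemma mem_dual a : intvec a -> dual_lattice L (a *m (invmx B)^T).
Proof. by move=> ia _ /latticeE[z iz ->]; rewrite dotv_dual dotv_int. Qed.

(* Point of the grid (1/m)L, and dual vector, with integer coordinates x and v. *)
Definition pt x : 'rV[R]_n := p.+1%:R^-1 *: (coords x *m B).
Definition freq v : 'rV[R]_n := coords v *m (invmx B)^T.

Let m0 : p.+1%:R != 0 :> R. Proof. by rewrite pnatr_eq0. Qed.

Lemma phaseE v x : dotv (freq v) (pt x) = phase v x.
Proof. by rewrite dotvZr dotv_dual mulrC. Qed.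

(** Modulo 1, the phase depends only on [pt x] modulo L and on [freq v] modulo m times the dual
    lattice. Both vectors may thus be replaced by short representatives. *)
Lemma phase_rep v x u w : lattice_set L (pt x - u) ->
  dual_lattice L (p.+1%:R^-1 *: (freq v - w)) ->
  exists2 z, z \is a Num.int & phase v x = dotv w u + z.
Proof.
move=> Lu Lw; exists (dotv (freq v) (pt x - u) + dotv (freq v - w) u).
  apply: rpredD.
    by have [z iz ->] := latticeE Lu; rewrite dotv_dual; apply: dotv_int iz; exact: intvec_coords.
  set F := _ *: _ in Lw.
  have -> : dotv (freq v - w) u = dotv F (p.+1%:R *: pt x) - p.+1%:R * dotv F (pt x - u).
    have -> : freq v - w = p.+1%:R *: F by rewrite /F scalerA divff// scale1r.
    move: (pt x) F {Lu Lw} => q F; rewrite -[- u]scaleN1r !(dotvDr, dotvZl, dotvZr).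
    by ring.
  rewrite /pt scalerA divff// scale1r rpredB// ?rpredM ?natr_int ?Lw//.
  exact/mem_lattice/intvec_coords.
rewrite -phaseE; move: (pt x) (freq v) {Lu Lw} => q f.
rewrite -[- u]scaleN1r -[- w]scaleN1r !(dotvDr, dotvDl) !(dotvZl, dotvZr).
by ring.
Qed.

Lemma chc_rep v x u w : lattice_set L (pt x - u) ->
  dual_lattice L (p.+1%:R^-1 *: (freq v - w)) -> chc v x = cos2pi (dotv w u).
Proof.
move=> Lu Lw; have [z iz e] := phase_rep Lu Lw.
by rewrite /chc e; have [-> _] := cos_sin2piDint (dotv w u) iz.
Qed.

Lemma chs_rep v x u w : lattice_set L (pt x - u) ->
  dual_lattice L (p.+1%:R^-1 *: (freq v - w)) -> chs v x = sin2pi (dotv w u).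
Proof.
move=> Lu Lw; have [z iz e] := phase_rep Lu Lw.
by rewrite /chs e; have [_ ->] := cos_sin2piDint (dotv w u) iz.
Qed.

Lemma norm2Z (c : R) a : norm2 (c *: a) = `|c| * norm2 a.
Proof.
by rewrite /norm2 dotvZl dotvZr mulrA -expr2 sqrtrM ?sqr_ge0// sqrtr_sqr.
Qed.

Lemma dotv_norm2 a b : `|dotv a b| <= norm2 a * norm2 b.
Proof.
by rewrite -sqrtr_sqr -sqrtrM ?dotv_ge0// ler_wsqrtr// dotv_cauchy.
Qed.

(** The factor 2 avoids showing that the infimum is attained. *)
Lemma covering (A : set 'rV[R]_n) a : (A !=set0)%classic -> 0 < covering_radius A ->
  exists2 z, A z & norm2 (a - z) <= 2 * covering_radius A.
Proof.
move=> [z0 Az0] r0; pose S : set R :=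
  [set inf [set norm2 (x - y) | y in A] | x in [set: 'rV[R]_n]]%classic.
(* Where no supremum exists, [sup] takes the value 0, which the positive radius excludes. *)
have hS : has_sup S.
  by apply: contrapT => /sup_out; rewrite -/(covering_radius A) => e; move: r0; rewrite e ltxx.
have hI : has_inf [set norm2 (a - y) | y in A]%classic.
  by split; [exists (norm2 (a - z0)), z0|exists 0 => _ [z _ <-]; exact: norm2_ge0].
have ler : inf [set norm2 (a - y) | y in A]%classic <= covering_radius A.
  by apply: ub_le_sup; [exact: hS.2|exists a].
have [_ [z Az <-] h] := inf_adherent r0 hI.
by exists z => //; lra.
Qed.

Lemma dual_cover v : 0 < covering_radius (dual_lattice L) ->
  exists2 w, dual_lattice L (p.+1%:R^-1 *: (freq v - w)) &
    norm2 w <= p.+1%:R * (2 * covering_radius (dual_lattice L)).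
Proof.
move=> r0; have ne : (dual_lattice L !=set0)%classic.
  exists 0 => y _; rewrite /dotv big1 ?rpred0// => i _; by rewrite mxE mul0r.
have [z Az zr] := covering (p.+1%:R^-1 *: freq v) ne r0.
exists (freq v - p.+1%:R *: z).
  by rewrite opprB addrC subrK scalerA mulVf// scale1r.
have -> : freq v - p.+1%:R *: z = p.+1%:R *: (p.+1%:R^-1 *: freq v - z).
  by rewrite scalerBr scalerA divff// scale1r.
by rewrite norm2Z ger0_norm// ler_wpM2l.
Qed.

Definition short_points (s : R) : {set G} :=
  [set h : G | `[< exists2 u, lattice_set L (pt h - u) & norm2 u <= s >]].

(** With N = n t, short representatives keep all angles below N/256, so N Taylor terms reproduce the
    rows of the short points up to 4 / 64^N. By [approximate_rank] there are at most C(n + N - 1, n)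
    <= (8 t)^n of these points, and m^n = (16 t)^n is at least twice that. *)
Lemma few_short t (s : R) : (0 < n)%N -> (0 < t)%N -> p.+1 = (16 * t)%N ->
  0 < covering_radius (dual_lattice L) ->
  0 <= s -> s * covering_radius (dual_lattice L) * 2 ^+ 16 <= n%:R ->
  (#|short_points s| * 2 <= #|{: G}|)%N.
Proof.
move=> n0 t0 mt r0 s0 sr; set r := covering_radius _ in r0 sr.
have cardG : #|{: G}| = (p.+1 ^ n)%N by rewrite card_mx card_ord mul1n.
suff : (#|short_points s| <= 'C(n + (n * t).-1, n))%N.
  move=> /leq_trans/(_ (bin_monomials_le n0 t0)) h.
  rewrite cardG; apply: leq_trans (leq_mul h (leqnn 2)) _.
  rewrite mt (_ : 16 = 8 * 2)%N// mulnAC [leqRHS]expnMn leq_mul//.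
  by rewrite -{1}(expn1 2) leq_exp2l.
have /choice[u uP] : forall i : 'I_#|short_points s|, exists u,
    lattice_set L (pt (enum_val i) - u) /\ norm2 u <= s.
  move=> i; have := enum_valP i; rewrite inE => /asboolP[u Lu us].
  by exists u.
have /choice[w wP] : forall v : G, exists w,
    dual_lattice L (p.+1%:R^-1 *: (freq v - w)) /\ norm2 w <= p.+1%:R * (2 * r).
  by move=> v; have [w ? ?] := dual_cover v r0; exists w.
pose N := (n * t)%N.
have N0 : (0 < N)%N by rewrite muln_gt0 n0.
(* The angle is at most 8 (2 m r) s = 256 t r s, and r s <= n / 2^16. *)
pose X : R := N%:R / 256.
have dotX i v : `|2 * pi * dotv (w v) (u i)| <= X.
  have pi4 : `|2 * pi| <= 8 :> R.
    by rewrite ger0_norm ?mulr_ge0 ?pi_ge0//; have := @pihalf_lt2 R; lra.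
  rewrite normrM (le_trans (ler_pM _ _ pi4 (dotv_norm2 _ _)))//.
  have h := ler_pM (norm2_ge0 _) (norm2_ge0 _) (wP v).2 (uP i).2.
  rewrite /X /N natrM.
  have e : 8 * (p.+1%:R * (2 * r) * s) = s * r * 2 ^+ 16 * t%:R / 256.
    by rewrite mt natrM; field.
  apply: (@le_trans _ _ (8 * (p.+1%:R * (2 * r) * s))); first by rewrite ler_pM2l.
  by rewrite e ler_pM2r ?invr_gt0// ler_wpM2r.
have XN : 2 * X <= N%:R by rewrite /X; have : 0 <= N%:R :> R by []; lra.
(* Taylor coefficients of cos + sin, which serves as a real substitute for the complex
   exponential. *)
pose a d := cos_coeff (1 : R) d + sin_coeff 1 d.
pose b d := a d * (2 * pi) ^+ d.
have [k [f [g [kE fg]]]] := poly_kernel_rank n N.-1 b.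
rewrite -kE; pose e : R := 4 * 64^-1 ^+ N.
have sumS (h : G) : \sum_(v : G) chs v h = 0 :> R.
  under eq_bigr => v _ do rewrite chsC.
  have [->|h0] := eqVneq h 0; last by have [_] := @sum_ch R n p h h0.
  rewrite big1// => v _.
  by rewrite chsC /chs /phase coords0 -(scale0r 0) dotvZr !mul0r /sin2pi mulr0 sin0.
apply: (@approximate_rank R G _ k (fun i v => chc v (enum_val i) + chs v (enum_val i))
  (fun i l => g l (u i)) (fun l v => f l (w v)) #|{: G}|%:R e).
(* The product of cos + sin at two points is the cosine of the difference plus the sine of the sum;
   the sines always sum to 0. *)
- move=> i j; transitivity (\sum_(v : G) (chc v (enum_val i - enum_val j) : R)
     + \sum_(v : G) chs v (enum_val i + enum_val j)).
    rewrite -big_split; apply: eq_bigr => v _ /=.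
    by rewrite chcB chsD; ring.
  rewrite sumS addr0; under eq_bigr => v _ do rewrite chcC.
  by rewrite sum_chc subr_eq0 (inj_eq enum_val_inj).
- move=> i v; have [Lu us] := uP i; have [Lw wr] := wP v.
  rewrite (chc_rep Lu Lw) (chs_rep Lu Lw).
  set th := 2 * pi * dotv (w v) (u i).
  have -> : \sum_l g l (u i) * f l (w v) =
      \sum_(d < N) cos_coeff th d + \sum_(d < N) sin_coeff th d.
    under eq_bigr => l _ do rewrite mulrC.
    rewrite -fg (prednK N0) -big_split; apply: eq_bigr => d _ /=.
    rewrite /b /a /th /cos_coeff /sin_coeff /= !expr1n [in RHS]exprMn.
    by ring.
  have := cos_taylor (dotX i v) XN; have := sin_taylor (dotX i v) XN.
  rewrite -/th -/(cos2pi _) -/(sin2pi _).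
  have := @expr_fact_le R X N _ _; rewrite /X divfK// => /(_ _ (lexx _)).
  have -> : 0 <= N%:R / 256 :> R by rewrite divr_ge0.
  move=> /(_ isT); rewrite /e -/X.
  set cs := \sum_(d < N) cos_coeff th d; set ss := \sum_(d < N) sin_coeff th d.
  set C := cos2pi _; set S := sin2pi _; set q := X ^+ N / _; set q' := _ ^+ N.
  by rewrite !ler_norml => ? /andP[? ?] /andP[? ?]; lra.
- rewrite -mulrA gtr_pMr ?ltr0n; last by rewrite cardG expn_gt0.
  apply: (@le_lt_trans _ _ ((p.+1 ^ n)%:R * e ^+ 2)).
    by rewrite ler_wpM2r ?sqr_ge0// ler_nat -cardG max_card.
  rewrite /e exprMn -exprM exprVn mulrA -[_ ^+ 2]natrX -natrM -[_ ^+ (_ * _)]natrX.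
  rewrite ltr_pdivrMr ?ltr0n ?expn_gt0// mul1r ltr_nat mt.
  exact: grid_lt_error.
Qed.

End TorusGrid.

(** * Test shifts: random signs and dyadic spikes *)

Section RandomSigns.
Context {R : realType} {n : nat}.
Implicit Types x : 'rV[R]_n.

Definition signs (eps : {ffun 'I_n -> bool}) : 'rV[R]_n := \row_i (-1) ^+ eps i.

Lemma norm2_signs eps : norm2 (signs eps) = Num.sqrt n%:R.
Proof.
rewrite /norm2 /dotv; under eq_bigr => i _ do rewrite mxE -expr2 sqrr_sign.
by rewrite sumr_const card_ord.
Qed.

(* Real part of the expansion of the product of exp(i x_j) + exp(- i x_j). *)
Lemma sum_cos_signs x :
  \sum_eps cos (dotv x (signs eps)) = 2 ^+ n * \prod_i cos (x 0 i).
Proof.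
pose E t : complex R := Complex (cos t) (sin t).
have ED t s : E (t + s) = E t * E s.
  by rewrite /E cosD sinD; congr Complex; rewrite addrC mulrC [X in _ + X]mulrC addrC.
have E0 : E 0 = 1 by rewrite /E cos0 sin0.
have ReD (z z' : complex R) : complex.Re (z + z') = complex.Re z + complex.Re z'.
  by case: z z' => [? ?] [? ?].
have -> : \sum_eps cos (dotv x (signs eps)) = complex.Re (\sum_eps E (dotv x (signs eps))).
  by rewrite (big_morph _ ReD (erefl : complex.Re 0 = 0)).
have -> : \sum_eps E (dotv x (signs eps)) =
    \prod_i \sum_(b : bool) E (x 0 i * (-1) ^+ b).
  rewrite bigA_distr_bigA; apply: eq_bigr => eps _.
  by rewrite /dotv (big_morph _ ED E0); apply: eq_bigr => i _; rewrite mxE.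
have -> : \prod_i \sum_(b : bool) E (x 0 i * (-1) ^+ b) =
    Complex (\prod_i (2 * cos (x 0 i))) 0.
  rewrite (big_morph (fun a : R => Complex a 0) (id1 := 1) (op1 := *%R))//; last first.
    move=> a b; apply/eqP; rewrite eq_complex /=; apply/andP; split; apply/eqP; ring.
  apply: eq_bigr => i _; rewrite big_bool /= expr1 expr0 mulrN1 mulr1 /E cosN sinN.
  by apply/eqP; rewrite eq_complex /=; apply/andP; split; apply/eqP; ring.
by rewrite /= big_split/= prodr_const card_ord.
Qed.

(** With y_i = x_i^2 / 4, each cosine is at most 1 - y_i <= 1 / (1 + y_i), and the product of the 1
    + y_i is at least 1 + sum y_i >= 65/64. *)
Lemma signs_gap x : 16^-1 <= dotv x x <= 1 ->
  \sum_eps cos (dotv x (signs eps)) <= 2 ^+ n * (64 / 65).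
Proof.
move=> /andP[xl xu]; rewrite sum_cos_signs ler_pM2l ?exprn_gt0//.
have x1 i : `|x 0 i| <= 1.
  by rewrite (le_trans (ler_coord_norm2 _ _))// -sqrtr1 ler_wsqrtr.
pose y i := x 0 i ^+ 2 / 4.
have y0 i : 0 <= y i by rewrite divr_ge0 ?sqr_ge0.
have prodD1 (s : seq 'I_n) : 1 + \sum_(i <- s) y i <= \prod_(i <- s) (1 + y i).
  elim: s => [|i s IH]; first by rewrite !big_nil addr0.
  rewrite !big_cons; apply: (@le_trans _ _ ((1 + y i) * (1 + \sum_(j <- s) y j))).
    have : 0 <= y i * \sum_(j <- s) y j by rewrite mulr_ge0// sumr_ge0.
    by lra.
  by rewrite ler_wpM2l// addr_ge0.
apply: (@le_trans _ _ (\prod_i (1 + y i)^-1)).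
  apply: ler_prod => i _; apply/andP; split.
    apply: cos_ge0_pihalf; have := x1 i; rewrite ler_norml => /andP[? ?].
    by have := @pihalf_ge1 R; lra.
  rewrite (le_trans (cos_le_quadratic (x1 i)))// -/(y i).
  have yp : 0 < 1 + y i by rewrite ltr_wpDr.
  rewrite -[leRHS]mul1r ler_pdivlMr//; have := sqr_ge0 (y i); lra.
rewrite prodfV (_ : 64 / 65 = (1 + 64^-1)^-1 :> R); last by field.
rewrite lef_pV2 ?posrE; last 2 first.
- by apply: prodr_gt0 => i _; rewrite ltr_wpDr.
- by rewrite ltr_wpDr.
apply: le_trans (prodD1 _); rewrite lerD2l -mulr_suml.
have -> : \sum_i x 0 i ^+ 2 = dotv x x by apply: eq_bigr => i _; rewrite expr2.
by move: xl; lra.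
Qed.

End RandomSigns.

Section Tests.
Context {R : realType} {n p : nat} (L : lattice R n) (B : 'M[R]_n).
Hypothesis Bu : B \in unitmx.
Hypothesis LE : lattice_set L =
  [set map_mx intr k *m B | k in [set: 'rV[int]_n]]%classic.
Let G := 'rV['I_p.+1]_n.
Implicit Types (x y v : G) (a b u w : 'rV[R]_n).

Let m0 : p.+1%:R != 0 :> R. Proof. by rewrite pnatr_eq0. Qed.

Lemma norm2_mulmx (k : nat) (c : 'rV[R]_k) (A : 'M[R]_(k, n)) (e : R) :
  (forall i, `|c 0 i| <= e) -> norm2 (c *m A) <= e * \sum_i norm2 (row i A).
Proof.
move=> ce; rewrite mulmx_sum_row mulr_sumr.
elim/big_ind2 : _ => [|x1 x2 y1 y2 h1 h2|i _].
- by rewrite norm20.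
- by rewrite (le_trans (norm2_triangle _ _))// lerD.
- by rewrite norm2Z ler_wpM2r// norm2_ge0.
Qed.

(** The coordinates of b are rounded down to multiples of 1/m, which gives u; h keeps only their
    residues, so its point agrees with u modulo L. *)
Lemma round_to_grid b : exists (h : G) (u : 'rV[R]_n), lattice_set L (pt B h - u) /\
  norm2 (u - b) <= p.+1%:R^-1 * \sum_i norm2 (row i B).
Proof.
pose c := b *m invmx B; pose k i : int := Num.floor (p.+1%:R * c 0 i).
pose h : G := \row_i inZp `|(k i %% p.+1)%Z|%N.
pose kR : 'rV[R]_n := \row_i (k i)%:~R.
exists h, (p.+1%:R^-1 *: (kR *m B)); split.
  rewrite /pt -scalerBr -mulmxBl scalemxAl; apply: (mem_lattice LE) => i.
  rewrite !mxE /=.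
  have kp : (k i %% p.+1)%Z = `|(k i %% p.+1)%Z|%N.
    by rewrite gez0_abs// modz_ge0.
  have -> : (`|(k i %% p.+1)%Z| %% p.+1)%N = `|(k i %% p.+1)%Z|%N.
    apply: modn_small; rewrite -ltz_nat -kp; exact: ltz_pmod.
  have e : (k i)%:~R = (k i %/ p.+1)%Z%:~R * p.+1%:R + (k i %% p.+1)%Z%:~R :> R.
    by rewrite {1}(divz_eq (k i) p.+1) rmorphD rmorphM.
  rewrite natr_absz ger0_norm ?modz_ge0// e.
  rewrite opprD addrCA subrr addr0 mulrN mulrC mulfK//.
  by rewrite rpredN intr_int.
have -> : p.+1%:R^-1 *: (kR *m B) - b = (p.+1%:R^-1 *: kR - c) *m B.
  by rewrite mulmxBl scalemxAl /c mulmxKV.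
apply: norm2_mulmx => i.
have -> : (p.+1%:R^-1 *: kR - c) 0 i = p.+1%:R^-1 * ((k i)%:~R - p.+1%:R * c 0 i).
  by rewrite !mxE mulrBr mulrA mulVf// mul1r.
rewrite normrM ger0_norm// -[leRHS]mulr1 ler_pM2l ?invr_gt0//.
have /andP[h1 h2] := mem_rg1_floor (p.+1%:R * c 0 i).
rewrite ler_norml; apply/andP; split; rewrite /k; lra.
Qed.

(* The representative of v with coordinates in ]-m/2, m/2]. *)
Definition centered v : 'rV[R]_n :=
  \row_i (if (2 * v 0%R i <= p.+1)%N then (v 0 i)%:R else (v 0 i)%:R - p.+1%:R).

Lemma intvec_centered v : intvec (centered v).
Proof. by move=> i; rewrite mxE; case: ifP => _; rewrite ?rpredB ?natr_int. Qed.

Lemma centered_le v i : `|centered v 0 i| <= p.+1%:R / 2.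
Proof.
have vi : (v 0 i)%:R <= p.+1%:R :> R by rewrite ler_nat ltnW.
rewrite mxE; case: leqP => [vs|vs].
  by rewrite ger0_norm// ler_pdivlMr// mulrC -natrM ler_nat.
rewrite ler0_norm ?subr_le0// opprB.
by move: vs; rewrite -(ltr_nat R) natrM; lra.
Qed.

Lemma centered_eq0 v : centered v = 0 -> v = 0.
Proof.
move=> /rowP v0; apply/rowP => i; move: (v0 i); rewrite !mxE.
case: ifP => _ => [|/eqP]; last by rewrite subr_eq0 eqr_nat ltn_eqF.
by move=> /eqP; rewrite pnatr_eq0 => /eqP h; apply/val_inj.
Qed.

Lemma centered_rep v :
  dual_lattice L (p.+1%:R^-1 *: (freq B v - centered v *m (invmx B)^T)).
Proof.
rewrite /freq -mulmxBl scalemxAl; apply: (mem_dual Bu LE) => i; rewrite !mxE.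
case: ifP => _; first by rewrite subrr mulr0 rpred0.
by rewrite subKr mulVf// rpred1.
Qed.

Lemma dyadic (N0 c : R) l : 0 < N0 -> N0 < c -> c <= 2 ^+ l * N0 ->
  exists2 k, (k < l)%N & 2 ^+ k * N0 < c <= 2 ^+ k.+1 * N0.
Proof.
move=> N00 N0c; elim: l => [|l IH] cl; first by move: cl; rewrite mul1r leNgt N0c.
have [h|h] := leP c (2 ^+ l * N0); last by exists l => //; rewrite h.
by have [k kl ?] := IH h; exists k => //; exact: ltnW.
Qed.

(** For m = 2^q and e + 2 <= q this is 2^-(e+2) times the i-th basis vector. A centered coordinate
    of size between 2^e and 2^(e+1) then has phase of size between 1/4 and 1/2, where the cosine is
    nonpositive. *)
Definition spike (q e : nat) (i : 'I_n) : G :=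
  \row_j if j == i then inZp (2 ^ (q - e.+2)) else 0.

Lemma pt_spike q e i : p.+1 = (2 ^ q)%N -> (e.+2 <= q)%N ->
  pt B (spike q e i) = 2^-1 ^+ e.+2 *: (delta_mx 0 i *m B).
Proof.
move=> pq eq; rewrite /pt.
have -> : coords (spike q e i) = (2 ^ (q - e.+2))%:R *: delta_mx 0 i :> 'rV[R]_n.
  apply/rowP => j; rewrite !mxE eqxx /=; have [_|_] := eqVneq j i; last by rewrite mulr0.
  by rewrite mulr1 /= modn_small// pq ltn_exp2l// ltn_subrL (leq_trans _ eq).
rewrite -scalemxAl scalerA; congr (_ *: _).
rewrite pq -{1}(subnK eq) expnD natrM invfM mulrAC mulVf ?mul1r ?natrX ?exprVn//.
Qed.

Lemma cos2pi_le0 (t : R) : 1 / 4 <= `|t| <= 1 / 2 -> cos2pi t <= 0.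
Proof.
move=> /andP[t4 t2]; have -> : cos2pi t = cos (2 * pi * `|t|).
  by case: (ger0P t) => // _; rewrite -[RHS]/(cos2pi (- t)) cos2piN.
rewrite -(subrK (pi / 2) (2 * pi * _)) cosDpihalf oppr_le0 sin_ge0_pi//.
have pi0 := @pi_gt0 R.
have := ler_wpM2l (ltW pi0) t4; have := ler_wpM2l (ltW pi0) t2.
by move=> h1 h2; apply/andP; split; lra.
Qed.

Lemma high_test q e v i : p.+1 = (2 ^ q)%N -> (e.+2 <= q)%N ->
  2 ^+ e < `|centered v 0 i| <= 2 ^+ e.+1 -> 1 <= 1 - chc v (spike q e i) :> R.
Proof.
move=> pq eq /andP[ve ve']; rewrite -{1}(subr0 1) lerD2l lerN2.
have L0 : lattice_set L (pt B (spike q e i) - pt B (spike q e i)).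
  by rewrite subrr; exact: lattice0.
rewrite (chc_rep Bu LE L0 (centered_rep v)) pt_spike// dotvZr dotv_dual//.
have -> : dotv (centered v) (delta_mx 0 i) = centered v 0 i.
  rewrite /dotv (bigD1 i)//= [delta_mx _ _ _ _]mxE !eqxx mulr1 big1 ?addr0// => j ji.
  by rewrite [delta_mx _ _ _ _]mxE (negbTE ji) andbF mulr0.
apply: cos2pi_le0; rewrite normrM ger0_norm ?exprn_ge0// exprVn.
have e0 : 0 < 2 ^+ e :> R by rewrite exprn_gt0.
move: ve'; rewrite !exprS => ve'.
have E : (2 * (2 * 2 ^+ e))^-1 * (2 ^+ e) = 1 / 4 :> R by field; rewrite gt_eqF.
have E2 : (2 * (2 * 2 ^+ e))^-1 * (2 * 2 ^+ e) = 1 / 2 :> R by field; rewrite gt_eqF.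
by rewrite -E -E2 !ler_pM2l ?invr_gt0 ?mulr_gt0// (ltW ve).
Qed.

(** Rounding moves each angle by at most 8/4160 = 1/520, hence each cosine by at most 1/130. Of the
    mean gap 1/65 from [signs_gap], 1/130 is left. *)
Lemma low_test v (c eta : R) (h : {ffun 'I_n -> bool} -> G)
    (u : {ffun 'I_n -> bool} -> 'rV[R]_n) :
  let w := centered v *m (invmx B)^T in
  (forall eps, lattice_set L (pt B (h eps) - u eps)) ->
  (forall eps, norm2 (u eps - c *: signs eps) <= eta) ->
  norm2 w * eta <= 4160^-1 ->
  0 <= c -> 4^-1 <= 2 * pi * c * norm2 w <= 1 ->
  130^-1 <= \sum_eps 2^-1 ^+ n * (1 - chc v (h eps)) :> R.
Proof.
move=> w Lu ueta weta c0 /andP[cl cu].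
have pi0 := @pi_gt0 R.
pose x := (2 * pi * c) *: w.
have xx : dotv x x = (2 * pi * c * norm2 w) ^+ 2.
  by rewrite /x dotvZl dotvZr exprMn /norm2 sqr_sqrtr ?dotv_ge0// mulrA expr2.
have /signs_gap gap : 16^-1 <= dotv x x <= 1.
  rewrite xx; set y := 2 * pi * c * norm2 w in cl cu *.
  by apply/andP; split; rewrite expr2; nra.
have close eps : (chc v (h eps) : R) <= cos (dotv x (signs eps)) + 130^-1.
  rewrite (chc_rep Bu LE (Lu eps) (centered_rep v)) -/w /cos2pi.
  have -> : 2 * pi * dotv w (u eps) = dotv x (signs eps) +
      2 * pi * dotv w (u eps - c *: signs eps).
    by rewrite -scaleN1r !(dotvDr, dotvZl, dotvZr); ring.
  have d : `|2 * pi * dotv w (u eps - c *: signs eps)| <= 520^-1.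
    rewrite normrM (ger0_norm (mulr_ge0 _ (ltW pi0)))//.
    have pi4 : 2 * pi <= 8 :> R by have := @pihalf_lt2 R; lra.
    have := ler_pM (mulr_ge0 _ (ltW pi0)) (normr_ge0 _) pi4
      (le_trans (dotv_norm2 w (u eps - c *: signs eps))
         (le_trans (ler_wpM2l (norm2_ge0 w) (ueta eps)) weta)).
    by move=> /(_ ltac:(done)) /le_trans; apply; lra.
  have := cos_perturb (dotv x (signs eps))
    (_ : `|2 * pi * dotv w (u eps - c *: signs eps)| <= 1 / 2).
  move=> /(_ ltac:(lra)); rewrite ler_norml => /andP[_]; lra.
apply: (@le_trans _ _ (\sum_(eps : {ffun 'I_n -> bool})
    2^-1 ^+ n * (1 - (cos (dotv x (signs eps)) + 130^-1)))).
  rewrite -mulr_sumr !sumrB big_split/=.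
  have -> : \sum_(eps : {ffun 'I_n -> bool}) 1 = 2 ^+ n :> R.
    by rewrite sumr_const card_ffun card_bool card_ord natrX.
  have -> : \sum_(eps : {ffun 'I_n -> bool}) 130^-1 = 2 ^+ n * 130^-1 :> R.
    by rewrite sumr_const card_ffun card_bool card_ord -[LHS]mulr_natl natrX.
  rewrite -(ler_pM2l (exprn_gt0 n (ltr0n R 2))) mulrA exprVn divff ?expf_neq0// mul1r.
  by move: gap; lra.
apply: ler_sum => eps _; rewrite ler_wpM2l ?exprn_ge0// lerD2l lerN2.
exact: close.
Qed.

End Tests.

Section GridTests.
Context {R : realType} {n p : nat} (L : lattice R n) (B : 'M[R]_n).
Hypothesis Bu : B \in unitmx.
Hypothesis LE : lattice_set L =
  [set map_mx intr k *m B | k in [set: 'rV[int]_n]]%classic.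
Let G := 'rV['I_p.+1]_n.
Let N0 := min_length (dual_lattice L).
Let beta := \sum_i norm2 (row i B).
Let beta' := \sum_i norm2 (row i (invmx B)^T).
Hypothesis n0 : (0 < n)%N.
Hypothesis N00 : 0 < N0.
(** Spikes handle the dual vectors with a centered coordinate above 2^g; the others have length at
    most W, and l dyadic scales starting at N0 / 2 reach W. A large [g] keeps the spikes short in
    total, and a large [q] makes the rounding errors negligible, both in the phases and in the total
    length. *)
Variables (g l q : nat).
Let W := 2 ^+ g * beta'.
Hypothesis pq : p.+1 = (2 ^ q)%N.
Hypothesis g_large : beta <= 2 ^+ g.+1 / N0.
Hypothesis l_large : W <= 2 ^+ l * (N0 / 2).
Hypothesis q_large1 : W * (p.+1%:R^-1 * beta) <= 4160^-1.
Hypothesis q_large2 : l%:R * (p.+1%:R^-1 * beta) <= N0^-1.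

(* Length per sqrt n of the k-th family of random signs: for a dual vector w with
   2^k N0 / 2 < norm2 w <= 2^k N0 the squared angles sum to a number in [1/16, 1]. *)
Let scale (k : nat) : R := (8 * 2 ^+ k * N0)^-1.

Let scale_ge0 k : 0 <= scale k.
Proof. by rewrite invr_ge0 !mulr_ge0// ltW. Qed.

Lemma min_length_dual_le w : dual_lattice L w -> w != 0 -> N0 <= norm2 w.
Proof.
move=> Lw w0; apply: ge_inf; first by exists 0 => _ [z _ <-]; exact: norm2_ge0.
by exists w => //; split => //; exact/eqP.
Qed.

Lemma centered_dual (v : G) : v != 0 -> N0 <= norm2 (centered v *m (invmx B)^T).
Proof.
move=> v0; apply: min_length_dual_le.
  by apply: (mem_dual Bu LE); exact: intvec_centered.
apply: contraNneq v0 => w0; apply/eqP/(@centered_eq0 R).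
have : (centered v *m (invmx B)^T) *m B^T = 0 :> 'rV[R]_n by rewrite w0 mul0mx.
by rewrite -mulmxA -trmx_mul mulmxV// trmx1 mulmx1.
Qed.

(** The geometric sums over scales bound the weighted length of the spikes by 1 / N0 and that of the
    signs by sqrt(n) / (4 N0), with 1 / N0 more for rounding. *)
Lemma grid_tests : exists (J : finType) (wt : J -> R) (h : J -> G) (u : J -> 'rV[R]_n),
  [/\ forall j, 0 <= wt j, forall j, lattice_set L (pt B (h j) - u j),
      \sum_j wt j * norm2 (u j) <= 3 * (Num.sqrt n%:R / N0) &
      forall v, v != 0 -> 130^-1 <= \sum_j wt j * (1 - chc v (h j))].
Proof.
have /choice[hu huP] : forall ke : 'I_l * {ffun 'I_n -> bool}, exists hu : G * 'rV[R]_n,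
    lattice_set L (pt B hu.1 - hu.2) /\
    norm2 (hu.2 - scale ke.1 *: signs ke.2) <= p.+1%:R^-1 * beta.
  move=> ke; have [h [u ?]] := @round_to_grid R n p L B Bu LE (scale ke.1 *: signs ke.2).
  by exists (h, u).
pose J : finType := (('I_n * 'I_q) + ('I_l * {ffun 'I_n -> bool}))%type.
(* Spikes finer than the grid get weight 0; each family of signs is averaged. *)
pose wt (j : J) : R := match j with
  | inl ie => ((g + ie.2).+2 <= q)%:R | inr _ => 2^-1 ^+ n end.
pose h (j : J) : G := match j with
  | inl ie => spike q (g + ie.2) ie.1 | inr ke => (hu ke).1 end.
pose u (j : J) : 'rV[R]_n := match j with
  | inl ie => pt B (spike q (g + ie.2) ie.1 : G) | inr ke => (hu ke).2 end.
have wt0 j : 0 <= wt j by case: j => j /=; rewrite ?ler0n ?exprn_ge0.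
have sqn : 1 <= Num.sqrt n%:R :> R by rewrite -[leLHS]sqrtr1 ler_wsqrtr// ler1n.
exists J, wt, h, u; split => //.
- by case=> j /=; [rewrite subrr; exact: lattice0|exact: (huP j).1].
- rewrite big_sumType/=.
  have high : \sum_(ie : 'I_n * 'I_q) ((g + ie.2).+2 <= q)%:R *
      norm2 (pt B (spike q (g + ie.2) ie.1 : G)) <= N0^-1.
    apply: (@le_trans _ _ (\sum_(ie : 'I_n * 'I_q)
        norm2 (row ie.1 B) * (2^-1 ^+ g.+2 * 2^-1 ^+ ie.2))).
      apply: ler_sum => -[i e] _ /=.
      have nb : 0 <= norm2 (row i B) * (2^-1 ^+ g.+2 * 2^-1 ^+ e).
        apply: mulr_ge0; [exact: norm2_ge0|by apply: mulr_ge0; apply: exprn_ge0].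
      case: leqP => eq; rewrite ?mul0r// mul1r.
      rewrite pt_spike// -rowE norm2Z ger0_norm ?exprn_ge0//.
      by rewrite -exprD addSn addSn mulrC.
    rewrite -(pair_bigA _ (fun i (e : 'I_q) => norm2 (row i B) * (2^-1 ^+ g.+2 * 2^-1 ^+ e)))/=.
    apply: (@le_trans _ _ (beta * (2^-1 ^+ g.+2 * 2))).
      rewrite mulr_suml; apply: ler_sum => i _; rewrite -!mulr_sumr.
      by rewrite !ler_wpM2l ?norm2_ge0 ?exprn_ge0// geometric_half_le.
    have := ler_wpM2r (_ : 0 <= 2^-1 ^+ g.+2 * 2) g_large.
    rewrite exprS mulrC mulrA divff// mul1r => /(_ ltac:(by rewrite exprn_ge0)).
    by rewrite exprVn mulrAC divff ?expf_neq0// mul1r mulrC.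
  have low : \sum_(ke : 'I_l * {ffun 'I_n -> bool}) 2^-1 ^+ n * norm2 (hu ke).2
      <= Num.sqrt n%:R / N0 / 4 + N0^-1.
    apply: (@le_trans _ _ (\sum_(ke : 'I_l * {ffun 'I_n -> bool})
        2^-1 ^+ n * (scale ke.1 * Num.sqrt n%:R + p.+1%:R^-1 * beta))).
      apply: ler_sum => ke _; rewrite ler_wpM2l ?exprn_ge0//.
      rewrite -(norm2_signs ke.2) -{1}(ger0_norm (scale_ge0 _)) -norm2Z addrC.
      rewrite -{1}(subrK (scale ke.1 *: signs ke.2) (hu ke).2).
      by rewrite (le_trans (norm2_triangle _ _))// lerD2r (huP ke).2.
    rewrite -(pair_bigA _ (fun (k : 'I_l) (eps : {ffun 'I_n -> bool}) =>
      2^-1 ^+ n * (scale k * Num.sqrt n%:R + p.+1%:R^-1 * beta)))/=.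
    under eq_bigr => k _.
      rewrite sumr_const card_ffun card_bool card_ord -[_ *+ _]mulr_natl natrX mulrA.
      rewrite exprVn divff ?expf_neq0// mul1r; over.
    rewrite big_split/= sumr_const card_ord -[_ *+ l]mulr_natl lerD//.
    rewrite -mulr_suml -mulrA [leRHS]mulrC.
    have -> : \sum_(k < l) scale k = (8 * N0)^-1 * \sum_(k < l) 2^-1 ^+ k.
      rewrite mulr_sumr; apply: eq_bigr => k _.
      by rewrite /scale mulrAC invfM exprVn.
    have := @geometric_half_le R l.
    move=> /(ler_wpM2l (_ : 0 <= (8 * N0)^-1 * Num.sqrt n%:R)).
    move=> /(_ ltac:(by rewrite mulr_ge0 ?invr_ge0 ?mulr_ge0 ?sqrtr_ge0 ?ltW)).
    rewrite mulrAC => /le_trans; apply.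
    by rewrite le_eqVlt; apply/orP; left; apply/eqP; field; rewrite gt_eqF.
  apply: (le_trans (lerD high low)).
  have : N0^-1 <= Num.sqrt n%:R / N0 by rewrite ler_peMl// invr_ge0 ltW.
  have : 0 < N0^-1 by rewrite invr_gt0.
  by lra.
- move=> v v0; rewrite big_sumType/=.
  have c1 x : 0 <= 1 - chc v x :> R by rewrite subr_ge0 cos_le1.
  have H0 : 0 <= \sum_(ie : 'I_n * 'I_q) ((g + ie.2).+2 <= q)%:R *
     (1 - chc v (spike q (g + ie.2) ie.1)) :> R.
    by apply: sumr_ge0 => ie _; rewrite mulr_ge0.
  have L0 : 0 <= \sum_(ke : 'I_l * {ffun 'I_n -> bool})
     2^-1 ^+ n * (1 - chc v (hu ke).1) :> R.
    by apply: sumr_ge0 => ke _; rewrite mulr_ge0// ?exprn_ge0.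
  have [[i ci]|] := pselect (exists i, 2 ^+ g < `|centered v 0 i| :> R).
    have ciq : `|centered v 0 i| <= 2 ^+ q * 2 ^+ g :> R.
      rewrite (le_trans (centered_le _ _))// pq natrX ler_pM ?exprn_ge0//.
      by rewrite (@le_trans _ _ 1) ?exprn_ege1 ?ler1n//; lra.
    have [k kq /andP[kc kc']] := dyadic (exprn_gt0 g (ltr0n R 2)) ci ciq.
    (* Centered coordinates are at most m/2 = 2^(q-1), so the grid resolves the scale found. *)
    have gkq : ((g + k).+2 <= q)%N.
      have := lt_le_trans kc (centered_le v i).
      rewrite ltr_pdivlMr// -exprD -exprSr pq natrX addnC.
      by rewrite ltr_eXn2l ?ltr1n.
    have := @high_test R n p L B Bu LE q (g + k) v i pq gkq.
    rewrite [(g + k)%N]addnC -addSn !exprD kc kc' => /(_ isT) high.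
    apply: (@le_trans _ _ (1 + 0)); first by lra.
    apply: lerD => //; rewrite (bigD1 (i, Ordinal kq))//= gkq mul1r addrC.
    rewrite (le_trans high)// addnC lerDr.
    by apply: sumr_ge0 => ie _; rewrite mulr_ge0.
  move=> /forallNP low; pose w := centered v *m (invmx B)^T.
  have wN : N0 <= norm2 w by exact: centered_dual.
  have wW : norm2 w <= W.
    by apply: norm2_mulmx => i; rewrite leNgt; apply/negP; exact: low.
  (* The scales start at N0 / 2 because [dyadic] wants a strict lower bound and the length may equal
     N0. *)
  have N2 : 0 < N0 / 2 by rewrite divr_gt0.
  have N2w : N0 / 2 < norm2 w by apply: lt_le_trans wN; lra.
  have [k kl /andP[kw kw']] := dyadic N2 N2w (le_trans wW l_large).
  have := @low_test R n p L B Bu LE v (scale k) (p.+1%:R^-1 * beta)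
    (fun eps => (hu (Ordinal kl, eps)).1) (fun eps => (hu (Ordinal kl, eps)).2).
  rewrite /= -/w => /(_ (fun eps => (huP (Ordinal kl, eps)).1)).
  move=> /(_ (fun eps => (huP (Ordinal kl, eps)).2)).
  have -> : norm2 w * (p.+1%:R^-1 * beta) <= 4160^-1.
    apply: le_trans q_large1; rewrite ler_wpM2r// mulr_ge0// sumr_ge0// => i _.
    exact: norm2_ge0.
  move=> /(_ isT (scale_ge0 k)).
  have e0 : 0 < 2 ^+ k * N0 by rewrite mulr_gt0// exprn_gt0.
  have -> : 4^-1 <= 2 * pi * scale k * norm2 w <= 1.
    have pi2 := @pi_ge2 R; have pi4 : pi < 4 :> R by have := @pihalf_lt2 R; lra.
    have -> : 2 * pi * scale k * norm2 w = pi * (norm2 w / (2 ^+ k * N0)) / 4.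
      by rewrite /scale -mulrA invfM; field; rewrite !gt_eqF// exprn_gt0.
    have y1 : 2^-1 <= norm2 w / (2 ^+ k * N0).
      by rewrite ler_pdivlMr//; move: kw; lra.
    have y2 : norm2 w / (2 ^+ k * N0) <= 1.
      by rewrite ler_pdivrMr//; move: kw'; rewrite exprS; lra.
    by set y := norm2 w / _ in y1 y2 *; apply/andP; split; nra.
  move=> /(_ isT) lowk; rewrite -[leLHS]add0r lerD//.
  have -> : \sum_(ke : 'I_l * {ffun 'I_n -> bool}) 2^-1 ^+ n * (1 - chc v (hu ke).1) =
      \sum_k \sum_eps 2^-1 ^+ n * (1 - chc v (hu (k, eps)).1) :> R.
    by rewrite pair_bigA; apply: eq_bigr => -[].
  rewrite (bigD1 (Ordinal kl))//= (le_trans lowk)// lerDl.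
  by apply: sumr_ge0 => ? _; apply: sumr_ge0 => ? _; rewrite mulr_ge0// ?exprn_ge0.
Qed.

End GridTests.

(** * Distances between grid points of the torus *)

Section TorusPoints.
Context {R : realType} {n p : nat} (L : lattice R n) (B : 'M[R]_n).
Hypothesis Bu : B \in unitmx.
Hypothesis LE : lattice_set L =
  [set map_mx intr k *m B | k in [set: 'rV[int]_n]]%classic.
Let G := 'rV['I_p.+1]_n.
Local Open Scope quotient_scope.
Implicit Types x y h : G.

Definition torus_pt x : torus L := \pi_(torus L) (pt B x).

Lemma pt_add x h : exists2 z, lattice_set L z & pt B (x + h) = pt B x + pt B h + z.
Proof.
have [z iz e] := @coordsD R n p x h; exists (z *m B); first exact: (mem_lattice LE).
rewrite /pt e !mulmxDl !scalerDr -scalemxAl scalerA mulVf ?scale1r//.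
Qed.

Lemma torus_pt_dist_le x h u : lattice_set L (pt B h - u) ->
  mdist (torus_pt x) (torus_pt (x + h)) <= norm2 u.
Proof.
move=> Lu; have [z Lz e] := pt_add x h.
rewrite [leLHS](torus_distE L (pt B x) (pt B (x + h))).
apply: ge_inf; first by exists 0 => _ [a _ <-]; exact: norm2_ge0.
exists (- (pt B h - u) - z); first by apply: latticeB => //; exact: latticeN.
rewrite -norm2N e; congr norm2; apply/rowP => i; rewrite !mxE; ring.
Qed.

Lemma torus_pt_dist_ge x h s : h \notin short_points L B s ->
  s <= mdist (torus_pt x) (torus_pt (x + h)).
Proof.
rewrite inE => /asboolP hs; have [z Lz e] := pt_add x h.
rewrite [leRHS](torus_distE L (pt B x) (pt B (x + h))).
apply: lb_le_inf; first exact: (coset_dist_has_inf L _ _).1.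
move=> _ [a La <-]; rewrite leNgt; apply/negP => ls; apply: hs.
exists (pt B h + (z + a)).
  by rewrite opprD addrA subrr sub0r; apply: latticeN; exact: latticeD.
rewrite (_ : pt B h + _ = - (pt B x - pt B (x + h) - a)) ?norm2N ?(ltW ls)//.
by rewrite e; apply/rowP => i; rewrite !mxE; ring.
Qed.

End TorusPoints.

(** * The lower bound for bilipschitz maps into L_1 *)

Section Bilipschitz.
Context {R : realType}.

Lemma pow2_ge (x : R) : exists k, x <= 2 ^+ k.
Proof.
exists (Num.truncn x).+1; rewrite -natrX.
rewrite (le_trans (ltW (truncnS_gt x)))// ler_nat ltnW//.
exact: ltn_expl.
Qed.

Lemma div_bound (c m x y : R) : 0 < c -> 0 < m ->
  c * (x * y) <= m -> x * (m^-1 * y) <= c^-1.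
Proof. by move=> c0 m0 h; rewrite mulrCA ler_pdivrMl// -[leRHS]mulrC ler_pdivlMl. Qed.

Lemma clear_denominators (A T N0 r x y : R) :
  0 < A -> 0 < T -> 0 < N0 -> 0 < r -> 0 < x ->
  x * x / (T * r) <= A * y * (x / N0) -> (A * T)^-1 * (N0 / r) * x <= y.
Proof.
move=> A0 T0 N00 r0 x0 h; have c0 : 0 < A * (x / N0) by rewrite mulr_gt0// divr_gt0.
rewrite -(ler_pM2r c0) [leRHS](_ : _ = A * y * (x / N0)); last by ring.
rewrite (le_trans _ h)// le_eqVlt; apply/orP; left; apply/eqP; field.
by rewrite !gt_eqF.
Qed.

(** The Poincare inequality is applied to the pulled-back metric. In 780 = 130 * 3 * 2 the factors
    come from the gap, the total test length and the half of the shifts that are not short; 2^16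
    comes from [few_short]. *)
Lemma bilipschitz_bound (n : nat) (L : lattice R n) (f : torus L -> L1 R) (a b : R) :
  (0 < n)%N -> 0 <= a -> 0 <= b ->
  0 < min_length (dual_lattice L) -> 0 < covering_radius (dual_lattice L) ->
  (forall x y, mdist (f x) (f y) <= a * mdist x y) ->
  (forall x y, mdist x y <= b * mdist (f x) (f y)) ->
  (780 * 2 ^+ 16)^-1 * (min_length (dual_lattice L) / covering_radius (dual_lattice L))
    * Num.sqrt n%:R <= a * b.
Proof.
set N0 := min_length _; set r := covering_radius _ => n0 a0 b0 N00 r0 fa fb.
have [B Bu LE] := latticeP L.
pose beta : R := \sum_i norm2 (row i B).
pose beta' : R := \sum_i norm2 (row i (invmx B)^T).
have beta0 : 0 <= beta by apply: sumr_ge0 => i _; exact: norm2_ge0.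
have beta'0 : 0 <= beta' by apply: sumr_ge0 => i _; exact: norm2_ge0.
have [g gP] := pow2_ge (beta * N0).
pose W := 2 ^+ g * beta'.
have W0 : 0 <= W by rewrite mulr_ge0// exprn_ge0.
have [l lP] := pow2_ge (W / (N0 / 2)).
have [K KE] : exists K : R, K = 4160 by exists 4160.
have K0 : 0 < K by rewrite KE ltr0n.
(* Both summands are nonnegative, so this single bound on m yields both rounding conditions. The
   exponent q0 + 4 below makes m a multiple of 16, as [few_short] requires. *)
have [q0 qP] := pow2_ge (K * (W * beta) + N0 * (l%:R * beta)).
have [p pq] : exists p, p.+1 = (2 ^ (q0 + 4))%N.
  by exists (2 ^ (q0 + 4)).-1; rewrite prednK// expn_gt0.
have pt16 : p.+1 = (16 * 2 ^ q0)%N by rewrite pq expnD mulnC.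
have m0 : 0 < p.+1%:R :> R by [].
have qm : K * (W * beta) + N0 * (l%:R * beta) <= p.+1%:R.
  by rewrite (le_trans qP)// pq natrX ler_weXn2l ?ler1n// leq_addr.
have Wb0 : 0 <= K * (W * beta).
  by apply: mulr_ge0; [exact: ltW|exact: mulr_ge0].
have lb0 : 0 <= N0 * (l%:R * beta).
  by apply: mulr_ge0; [exact: ltW|apply: mulr_ge0].
have [J [wt [h [u [wt0 Lu cost gap]]]]] : exists (J : finType) (wt : J -> R)
    (h : J -> 'rV['I_p.+1]_n) (u : J -> 'rV[R]_n),
  [/\ forall j, 0 <= wt j, forall j, lattice_set L (pt B (h j) - u j),
      \sum_j wt j * norm2 (u j) <= 3 * (Num.sqrt n%:R / N0) &
      forall v, v != 0 -> 130^-1 <= \sum_j wt j * (1 - chc v (h j))].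
  apply: (@grid_tests R n p L B Bu LE n0 N00 g l (q0 + 4) pq).
  - by rewrite ler_pdivlMr// (le_trans gP)// ler_weXn2l// ler1n.
  - by move: lP; rewrite ler_pdivrMr// divr_gt0.
  - by rewrite -KE; apply: div_bound => //; apply: le_trans qm; rewrite lerDl.
  - by apply: div_bound => //; apply: le_trans qm; rewrite lerDr.
pose G := 'rV['I_p.+1]_n.
pose D (x y : G) := mdist (f (torus_pt L B x)) (f (torus_pt L B y)).
pose M : R := #|{: G}|%:R.
have M0 : 0 < M by rewrite ltr0n; apply/card_gt0P; exists 0.
have key : 130^-1 * \sum_h shift_sum D h <= M * \sum_j wt j * shift_sum D (h j).
  apply: (@poincare R G G chc chs 0).
  - exact: chcB.
  - exact: chc0.
  - exact: chcN.
  - exact: chsN.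
  - by move=> x; rewrite chcC chc0.
  - by move=> x; under eq_bigr => v _ do rewrite chcC; rewrite sum_chc.
  - by move=> v v0; rewrite (@sum_ch R n p v v0).1.
  - by move=> v v0; rewrite (@sum_ch R n p v v0).2.
  - by move=> x; rewrite /D mdistxx.
  - by move=> x y; rewrite /D metric_sym.
  - by move=> w w0; apply: L1_negative_type.
  - exact: gap.
have upper : \sum_j wt j * shift_sum D (h j) <= M * (a * (3 * (Num.sqrt n%:R / N0))).
  apply: (@le_trans _ _ (\sum_j M * (a * (wt j * norm2 (u j))))); last first.
    by rewrite -!mulr_sumr ler_wpM2l ?(ltW M0)// ler_wpM2l.
  apply: ler_sum => j _; 
  rewrite (_ : M * _ = wt j * (M * (a * norm2 (u j)))); last by ring.
  rewrite ler_wpM2l// /M mulr_natl -sumr_const; apply: ler_sum => x _.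
  by rewrite (le_trans (fa _ _))// ler_wpM2l// torus_pt_dist_le.
pose s := n%:R / (2 ^+ 16 * r).
have s0 : 0 <= s by rewrite divr_ge0// mulr_ge0 ?exprn_ge0// ltW.
have few : (#|short_points L B s : {set G}| * 2 <= #|{: G}|)%N.
  apply: (few_short Bu LE (t := 2 ^ q0)) => //; first by rewrite expn_gt0.
  by rewrite /s le_eqVlt; apply/orP; left; apply/eqP; rewrite -/r; field; rewrite gt_eqF.
(* At least half of the M shifts are not short, and each of them gives M pairs at torus distance at
   least s. *)
have lower : M * (M * s) <= 2 * b * \sum_h shift_sum D h.
  pose A := ~: (short_points L B s : {set G}).
  have cardA : M <= 2 * #|A|%:R.
    rewrite -natrM ler_nat; move: few.
    by rewrite -(cardsC (short_points L B s : {set G})) -/A muln2 -addnn leq_add2l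
      mul2n -addnn leq_add2r.
  apply: (@le_trans _ _ (2 * \sum_(h in A) M * s)).
    rewrite sumr_const -[M * s *+ _]mulr_natl [leRHS]mulrA ler_wpM2r//.
    by apply: mulr_ge0 => //; exact: ltW.
  rewrite -mulrA ler_wpM2l// mulr_sumr [leRHS](bigID (mem A))/= -[leLHS]addr0.
  apply: lerD.
    apply: ler_sum => k kA; rewrite /shift_sum mulr_sumr /M mulr_natl -sumr_const.
    apply: ler_sum => x _; rewrite (le_trans _ (fb _ _))// torus_pt_dist_ge//.
    by move: kA; rewrite inE.
  apply: sumr_ge0 => k _; rewrite mulr_ge0//; apply: sumr_ge0 => x _.
  exact: mdist_ge0.
have final : s <= 780 * (a * b) * (Num.sqrt n%:R / N0).
  rewrite -(ler_pM2l M0) -(ler_pM2l M0) (le_trans lower)//.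
  have := le_trans key (ler_wpM2l (ltW M0) upper).
  set S := \sum_h _; set y := Num.sqrt _ / _ => h1.
  have := ler_wpM2l b0 h1; lra.
have sq : Num.sqrt n%:R * Num.sqrt n%:R = n%:R :> R by rewrite -expr2 sqr_sqrtr.
have sq0 : 0 < Num.sqrt n%:R :> R by rewrite sqrtr_gt0 ltr0n.
have A0 : 0 < 780 :> R by rewrite ltr0n.
have T0 : 0 < 2 ^+ 16 :> R by rewrite exprn_gt0.
by apply: (clear_denominators A0 T0 N00 r0 sq0); rewrite sq.
Qed.

End Bilipschitz.

(** * From bilipschitz bounds to distortion *)

Section DistortionBound.
Context {R : realType}.

Lemma Lip_ratio (X Y : metricType R) (f : X -> Y) x y : x != y ->
  ((mdist (f x) (f y) / mdist x y)%:E <= Lip f)%E.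
Proof. by move=> xy; apply: ereal_sup_ubound; right; exists x, y. Qed.

Lemma Lip_mdist (X Y : metricType R) (f : X -> Y) (a : R) x y :
  Lip f = a%:E -> mdist (f x) (f y) <= a * mdist x y.
Proof.
move=> fa; have [->|xy] := eqVneq x y; first by rewrite !mdistxx mulr0.
have := Lip_ratio f xy; rewrite fa lee_fin ler_pdivrMr//.
by rewrite mdist_gt0.
Qed.

Lemma Lip_gt0 (X Y : metricType R) (f : X -> Y) x y : f x != f y -> (0 < Lip f)%E.
Proof.
move=> fxy; have xy : x != y by apply: contraNneq fxy => ->.
apply: lt_le_trans (Lip_ratio f xy); rewrite lte_fin divr_gt0//.
  by rewrite mdist_gt0.
by rewrite mdist_gt0.
Qed.

Lemma image_invE (X Y : metricType R) (f : X -> Y) (x : X) : injective f ->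
  exists u : image_space f, val u = f x /\ image_inv u = x.
Proof.
move=> fi; have fx : f x \in range f by apply/mem_set; exists x.
exists (exist _ (f x) fx); split => //.
by apply: fi; rewrite image_invK.
Qed.

(** Two distinct points make both Lipschitz constants positive, so an infinite factor gives the
    product +oo and never 0 times infinity. *)
Lemma le_distortion (X Y : metricType R) (f : X -> Y) (c : R) (x0 y0 : X) :
  x0 != y0 ->
  (forall a b : R, 0 <= a -> 0 <= b ->
    (forall x y, mdist (f x) (f y) <= a * mdist x y) ->
    (forall x y, mdist x y <= b * mdist (f x) (f y)) -> c <= a * b) ->
  (c%:E <= distortion f)%E.
Proof.
move=> xy H; rewrite /distortion; case: asboolP => [fi|_]; last by rewrite leey.
have f0 : (0 < Lip f)%E.
  by apply: (@Lip_gt0 _ _ f x0 y0); apply: contra_neq xy => /fi.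
have g0 : (0 < Lip (@image_inv R X Y f))%E.
  have [u [_ ux]] := image_invE x0 fi; have [v [_ vy]] := image_invE y0 fi.
  by apply: (@Lip_gt0 _ _ _ u v); rewrite ux vy.
case Ef : (Lip f) f0 => [a| |]// a0; last by rewrite gt0_mulye// leey.
case Eg : (Lip _) g0 => [b| |]// b0; last by rewrite gt0_muley// leey.
rewrite -EFinM lee_fin; move: a0 b0; rewrite !lte_fin => a0 b0.
apply: H; [exact: ltW|exact: ltW| |].
  by move=> x y; exact: Lip_mdist.
move=> x y; have [u [uf ux]] := image_invE x fi; have [v [vf vy]] := image_invE y fi.
by have := Lip_mdist u v Eg; rewrite ux vy -uf -vf.
Qed.

Lemma torus_nontrivial (n : nat) (L : lattice R n) : (0 < n)%N ->
  exists x y : torus L, x != y.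
Proof.
move=> n0; have [B Bu LE] := latticeP L.
pose i : 'I_n := Ordinal n0; pose e : 'rV[R]_n := 2^-1 *: delta_mx 0 i.
exists (\pi_(torus L)%qT (e *m B)), (\pi_(torus L)%qT 0).
apply/negP => /eqP/(@eqmodP _ (lattice_eq_canonical L))/asboolP.
rewrite subr0 => /(latticeE LE)[z iz] /(can_inj (mulmxK Bu)) ez.
have : (2^-1 : R) \is a Num.int.
  by have := iz i; rewrite -ez !mxE !eqxx mulr1.
move=> /(@norm_intr_ge1 R); rewrite invr_eq0 pnatr_eq0 ger0_norm// => /(_ isT).
by lra.
Qed.

End DistortionBound.

Theorem theorem5p1 (R : realType) :
  exists c : R, 0 < c /\
    forall (n : nat) (L : lattice R n), (1 <= n)%N ->
      ((c * (min_length (dual_lattice L) / covering_radius (dual_lattice L))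
          * Num.sqrt n%:R)%:E <= c1 (torus L))%E.
Proof.
have : 0 < (780 * 2 ^+ 16)^-1 :> R.
  by rewrite invr_gt0; apply: mulr_gt0; [rewrite ltr0n|exact: exprn_gt0].
have := @bilipschitz_bound R; move: (_^-1) => c bound c0.
exists c; split=> // n L n0; apply: le_ereal_inf_tmp => _ [f _ <-].
have [x [y xy]] := torus_nontrivial L n0.
apply: (le_distortion xy) => a b a0 b0 fa fb.
have N0 : 0 <= min_length (dual_lattice L).
  have [ne|/set0P/negP] := pselect (exists x, [set norm2 x | x in dual_lattice L `\ 0]%classic x).
    by apply: lb_le_inf => // _ [z _ <-]; exact: norm2_ge0.
  by rewrite negbK /min_length => /eqP ->; rewrite inf0.
(* If the minimal length is 0 or the radius is not positive, the left side is at most 0 and the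
   bound is trivial; otherwise [bilipschitz_bound] applies. *)
have [N00|N0'] := ltP 0 (min_length (dual_lattice L)); last first.
  have -> : min_length (dual_lattice L) = 0 by apply/eqP; rewrite eq_le N0 N0'.
  by rewrite mul0r mulr0 mul0r mulr_ge0.
have [r0|r0] := ltP 0 (covering_radius (dual_lattice L)).
  exact: bound fa fb.
apply: (@le_trans _ _ 0); last exact: mulr_ge0.
by rewrite mulr_le0_ge0 ?sqrtr_ge0// mulr_ge0_le0 ?(ltW c0)// mulr_ge0_le0// invr_le0.
Qed.
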